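(* Let $X,U,V$ be Banach spaces, let $A:D(A)\subset X\to X$ generate a $C_0$-semigroup $T=(T(t))_{t\ge 0}$ on $X$, let $B\in L(U,X_{-1})$, $B_2\in L(V,X_{-1})$ and $f:X\times U\to V$. Assume: (a) $B$ is $\infty$-admissible for $T$, and the map $(t,u)\mapsto \Phi(t)u:=\int_0^tT_{-1}(t-s)Bu(s)\,ds$ is continuous from $\mathbb{R}_+\times L^\infty(\mathbb{R}_+,U)$ to $X$; (b) $B_2$ is zero-class $\infty$-admissible for $T$, and for all $u\in L^\infty(\mathbb{R}_+,U)$ and all $x\in C(\mathbb{R}_+,X)$ the map $s\mapsto f(x(s),u(s))$ is in $L^\infty_{loc}(\mathbb{R}_+,V)$. Let $\mathcal{U}:=L^\infty(\mathbb{R}_+,U)$ and suppose that the system $$\dot x(t)=Ax(t)+B_2f(x(t),u(t))+Bu(t),\qquad x(0)=x_0,$$ is well-posed, i.e. for every $x_0\in X$ and every $u\in\mathcal{U}$ there exists a unique maximal mild solution $\phi(\cdot,x_0,u):[0,t_m(x_0,u))\to X$ with $0<t_m(x_0,u)\le\infty$. Let $\phi$ be the resulting flow map, with domain $D_\phi=\bigcup_{x_0\in X,\,u\in\mathcal{U}}[0,t_m(x_0,u))\times\{(x_0,u)\}$. Then the triple $(X,\mathcal{U},\phi)$ is a control system.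
   Context: $X_{-1}$ is the completion of $X$ in the norm $x\mapsto\|(aI-A)^{-1}x\|_X$ with some $a\in\rho(A)$; $T$ extends uniquely to a $C_0$-semigroup $T_{-1}=(T_{-1}(t))_{t\ge0}$ on $X_{-1}$. $L^\infty_{loc}(\mathbb{R}_+,Y)$: strongly measurable functions $\mathbb{R}_+\to Y$ that are essentially bounded on every $[0,t]$. An operator $B\in L(U,X_{-1})$ is $\infty$-admissible for $T$ if there is $t>0$ such that $\int_0^tT_{-1}(t-s)Bu(s)\,ds\in X$ for all $u\in L^\infty_{loc}(\mathbb{R}_+,U)$. Equivalently (known fact), for every $t>0$ there is $h_t>0$ such that for all $u\in L^\infty_{loc}(\mathbb{R}_+,U)$ this integral lies in $X$ and has $X$-norm at most $h_t\|u\|_{L^\infty([0,t],U)}$; $t\mapsto h_t$ is assumed (without loss of generality) nondecreasing. $B$ is zero-class $\infty$-admissible if the constants can be chosen with $\lim_{t\to+0}h_t=0$. The same definitions apply to $B_2$ with $V$ in place of $U$. A mild solution on $[0,\tau]$ is a function $x\in C([0,\tau],X)$ such that for all $t\in[0,\tau]$ $$x(t)=T(t)x_0+\int_0^tT_{-1}(t-s)B_2f(x(s),u(s))\,ds+\int_0^tT_{-1}(t-s)Bu(s)\,ds,$$ with Bochner integrals of $X_{-1}$-valued maps. A function on $[0,t_1)$ is a mild solution if its restriction to $[0,\tau]$ is one for every $\tau\in(0,t_1)$. A mild solution $x_2$ on $[0,t_2)$ extends a mild solution $x_1$ on $[0,t_1)$ if $t_2>t_1$ and $x_2=x_1$ on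 $[0,t_1)$. A solution is maximal if no solution (for the same $x_0,u$) extends it. Control system: a triple $\Sigma=(X,\mathcal{U},\phi)$ where (i) $X$ is a normed vector space; (ii) $\mathcal{U}\subset\{u:\mathbb{R}_+\to U\}$ is a normed vector space of inputs, $U$ being a normed vector space, such that: (shift invariance) for all $u\in\mathcal{U}$, $\tau\ge0$, the shift $u(\cdot+\tau)$ belongs to $\mathcal{U}$ with $\|u\|_{\mathcal{U}}\ge\|u(\cdot+\tau)\|_{\mathcal{U}}$; (concatenation) for all $u_1,u_2\in\mathcal{U}$ and $t>0$, the function equal to $u_1(\tau)$ for $\tau\in[0,t]$ and to $u_2(\tau-t)$ for $\tau>t$ belongs to $\mathcal{U}$; (iii) $\phi:D_\phi\to X$, $D_\phi\subseteq\mathbb{R}_+\times X\times\mathcal{U}$, is such that for all $(x,u)\in X\times\mathcal{U}$ one has $D_\phi\cap(\mathbb{R}_+\times\{(x,u)\})=[0,t_m)\times\{(x,u)\}$ for some $t_m=t_m(x,u)\in(0,+\infty]$; and the following hold: ($\Sigma$1) identity: $\phi(0,x,u)=x$ for all $(x,u)$; ($\Sigma$2) causality: for every $(t,x,u)\in D_\phi$ and every $\tilde u\in\mathcal{U}$ with $u(s)=\tilde u(s)$ for all $s\in[0,t]$, one has $[0,t]\times\{(x,\tilde u)\}\subset D_\phi$ and $\phi(t,x,u)=\phi(t,x,\tilde u)$; ($\Sigma$3) continuity: for each $(x,u)$ the map $t\mapsto\phi(t,x,u)$ is continuous on $[0,t_m(x,u))$; ($\Sigma$4) cocycle property: for all $x\in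 X$, $u\in\mathcal{U}$, $t,h\ge0$ with $[0,t+h]\times\{(x,u)\}\subset D_\phi$, $\phi(h,\phi(t,x,u),u(t+\cdot))=\phi(t+h,x,u)$. *)

(* Defs.v *)
From HB Require Import structures.
From mathcomp Require Import all_boot all_order all_algebra.
From mathcomp Require Import generic_quotient ring_quotient complex.
From mathcomp Require Import all_classical all_reals all_analysis.
From mathcomp Require Import ess_sup_inf.

Set Implicit Arguments.
Unset Strict Implicit.
Unset Printing Implicit Defensive.

Import Order.TTheory GRing.Theory Num.Theory.
Import numFieldNormedType.Exports.

Local Open Scope classical_set_scope.
Local Open Scope ring_scope.
Local Open Scope quotient_scope.

(* The scalar field of the Banach spaces is R or C; time is real in both
   cases. *)

Variant field_kind := RealField | ComplexField.

Definition base_field (R : realType) (c : field_kind) : numFieldType :=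
  match c with RealField => R | ComplexField => R[i] end.

Definition of_real (R : realType) (c : field_kind) : R -> base_field R c :=
  match c with RealField => id | ComplexField => fun r => Complex r 0 end.

Definition re_part (R : realType) (c : field_kind) : base_field R c -> R :=
  match c with RealField => id | ComplexField => fun z => complex.Re z end.

Arguments re_part {R c} _.

(* The norm of a [normedModType K] takes values in [K]; this is the same
   number seen in [R]. *)
Definition rnorm (R : realType) (c : field_kind)
  (X : normedModType (base_field R c)) (x : X) : R := re_part `|x|.

Section scalar_theory.
Context {R : realType} {c : field_kind}.
Local Notation K := (base_field R c).

Lemma re_partK (z : K) : 0 <= z -> of_real c (re_part z) = z.
Proof.
case: c z => //= -[a b] /=.
by rewrite lecE /= => /andP[/eqP -> _].
Qed.

Lemma re_part_ge0 (z : K) : 0 <= z -> 0 <= re_part z.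
Proof. by case: c z => //= -[a b] /=; rewrite lecE /= => /andP[]. Qed.

Lemma of_realK (r : R) : re_part (of_real c r) = r.
Proof. by case: c. Qed.

Lemma of_real_le (r s : R) : (of_real c r <= of_real c s) = (r <= s).
Proof. by case: c => //=; rewrite lecE /= eqxx. Qed.

Lemma of_realD (r s : R) : of_real c (r + s) = of_real c r + of_real c s.
Proof. by case: c => //=; apply/eqP; rewrite eq_complex /= addr0 !eqxx. Qed.

Lemma of_realM (r s : R) : of_real c (r * s) = of_real c r * of_real c s.
Proof.
case: c => //=; apply/eqP.
by rewrite eq_complex /= !mulr0 mul0r subr0 addr0 !eqxx.
Qed.

Lemma of_real0 : of_real c (0 : R) = 0.
Proof. by case: c. Qed.

Lemma of_real_inj : injective (of_real c : R -> K).
Proof. by move=> r s /(congr1 re_part); rewrite !of_realK. Qed.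

Variable X : normedModType K.
Implicit Types x y : X.

Lemma rnormE x : `|x| = of_real c (rnorm x).
Proof. by rewrite re_partK. Qed.

Lemma rnorm_ge0 x : 0 <= rnorm x.
Proof. exact: re_part_ge0. Qed.

Lemma rnormD x y : rnorm (x + y) <= rnorm x + rnorm y.
Proof. by rewrite -(of_real_le) of_realD -!rnormE ler_normD. Qed.

Lemma rnormZ (a : K) x : rnorm (a *: x) = re_part `|a| * rnorm x.
Proof.
by apply: of_real_inj; rewrite of_realM -!rnormE normrZ re_partK.
Qed.

Lemma rnorm0 : rnorm (0 : X) = 0.
Proof. by apply: of_real_inj; rewrite -rnormE normr0 of_real0. Qed.

Lemma rnorm_eq0 x : rnorm x = 0 -> x = 0.
Proof. by move=> x0; apply: normr0_eq0; rewrite rnormE x0 of_real0. Qed.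

End scalar_theory.

Section bochner.
Context {R : realType} {c : field_kind}.
Variable X : normedModType (base_field R c).
Implicit Types (D : set R) (f s : R -> X).
Local Notation mu := (@lebesgue_measure R).

Definition simple_fun s :=
  finite_set (range s) /\
  forall v, measurable (s @^-1` [set v] : set (measurableTypeR R)).

Definition strongly_measurable D f :=
  exists2 s : nat -> R -> X, (forall n, simple_fun (s n)) &
    \forall x \ae mu, D x -> s n x @[n --> \oo] --> f x.

(* meaningful when [D] has finite measure *)
Definition simple_integral D s : X :=
  \sum_(v \in range s) of_real c (fine (mu (D `&` s @^-1` [set v]))) *: v.

(* [f] is Bochner integrable on the set [D] of finite measure, with
   integral [y]. *)
Definition is_bochner_integral D f (y : X) :=
  exists s : nat -> R -> X,
    [/\ forall n, simple_fun (s n),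
        \forall x \ae mu, D x -> s n x @[n --> \oo] --> f x,
        (\int[mu]_(x in D) (rnorm (f x - s n x))%:E)%E @[n --> \oo]
          --> (0 : \bar R) &
        simple_integral D (s n) @[n --> \oo] --> y].

(* [f] is cut off by 0 outside [D], which does not affect the essential
   supremum of a nonnegative function over a [D] of positive measure. *)
Definition ess_norm D f : \bar R :=
  ess_sup mu (EFin \o ((fun x => rnorm (f x)) \_ D)).

Definition ess_bounded D f := (ess_norm D f < +oo)%E.

End bochner.

(* Functions on R_+ are represented by functions on [R] whose values at
   negative arguments are irrelevant. *)

Section Linf_fun.
Context {R : realType} {c : field_kind}.
Variable X : normedModType (base_field R c).
Local Notation mu := (@lebesgue_measure R).
Local Notation Rp := (`[0, +oo[%classic : set R).

Let ae_filter : Filter (almost_everywhere mu) := ae_filter_ringOfSetsType mu.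

Let aeS := @filterS _ _ ae_filter.

Let aeI := @filterI _ _ ae_filter.

Definition is_Linf_loc (u : R -> X) :=
  strongly_measurable Rp u /\
  forall t : R, 0 <= t -> ess_bounded `[0, t]%classic u.

Definition is_Linf (u : R -> X) :=
  strongly_measurable Rp u /\ ess_bounded Rp u.

Lemma simple_funP (Y : normedModType (base_field R c)) (g : X -> Y -> X)
    (s : R -> X) (t : R -> Y) :
  simple_fun s -> simple_fun t -> simple_fun (fun x => g (s x) (t x)).
Proof.
move=> [fs ms] [ft mt]; split; first exact: (finite_image11 g fs ft).
move=> v; set A := [set p | range s p.1 /\ range t p.2 /\ g p.1 p.2 = v].
have -> : (fun x => g (s x) (t x)) @^-1` [set v] =
    \bigcup_(p in A) (s @^-1` [set p.1] `&` t @^-1` [set p.2]).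
  apply/seteqP; split=> [x /= gv|x [[p q] /= [_ [_ <-]]] [<- <-]] //.
  by exists (s x, t x) => //; rewrite /A /= gv; do 2?[split => //]; exists x.
apply: fin_bigcup_measurable => [|p _]; last exact: measurableI.
apply: (@sub_finite_set _ _ (range s `*` range t)); last exact: finite_setX.
by move=> p [? [? _]].
Qed.

Lemma simple_fun_cst (v : X) : simple_fun (fun=> v).
Proof.
split; first by apply: (@sub_finite_set _ _ [set v]); [move=> _ [x _ <-]|exact: finite_set1].
move=> w; have [->|wv] := pselect (w = v).
  by rewrite (_ : _ @^-1` _ = setT) //; apply/seteqP; split.
by rewrite (_ : _ @^-1` _ = set0) //; apply/seteqP; split=> // x /esym.
Qed.

Lemma strongly_measurable_lin D (a : base_field R c) (u v : R -> X) :
  strongly_measurable D u -> strongly_measurable D v ->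
  strongly_measurable D (a *: u + v).
Proof.
move=> [s ss su] [t st tv].
exists (fun n x => a *: s n x + t n x).
  by move=> n; exact: (simple_funP (fun x y : X => a *: x + y)).
apply: (filterS2 ae_filter _ su tv) => x sux tvx Dx.
by apply: cvgD; [apply: cvgZr; exact: sux|exact: tvx].
Qed.

Lemma ess_norm_ge0 D (u : R -> X) : (0 <= ess_norm D u)%E.
Proof.
have muT : (0 < mu [set: R])%E.
  by rewrite -set_itvNyy lebesgue_measure_itv /= ltry.
apply: ess_sup_gee; first exact: muT.
apply: (nearW ae_filter) => x /=; rewrite lee_fin patchE.
by case: ifP => _ //; exact: rnorm_ge0.
Qed.

Lemma ess_bounded_lin D (a : base_field R c) (u v : R -> X) :
  ess_bounded D u -> ess_bounded D v -> ess_bounded D (a *: u + v).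
Proof.
move=> /ess_supr_bounded[M uM] /ess_supr_bounded[N vN].
apply: (@le_lt_trans _ _ (re_part `|a| * M + N)%:E); last exact: ltry.
apply/ess_supP; apply: (filterS2 ae_filter _ uM vN) => x /=; rewrite !patchE.
case: ifP => _ uMx vNx; rewrite lee_fin.
  apply: (le_trans (rnormD _ _)); apply: lerD => //.
  by rewrite rnormZ ler_wpM2l // re_part_ge0.
by rewrite addr_ge0 // mulr_ge0 // re_part_ge0.
Qed.

Lemma is_Linf_lin (a : base_field R c) (u v : R -> X) :
  is_Linf u -> is_Linf v -> is_Linf (a *: u + v).
Proof.
move=> [mu_ bu] [mv bv]; split; first exact: strongly_measurable_lin.
exact: ess_bounded_lin.
Qed.

Lemma is_Linf0 : is_Linf (0 : R -> X).
Proof.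
split.
  exists (fun _ _ => 0) => [_|]; first exact: simple_fun_cst.
  by apply: (nearW ae_filter) => x _; exact: cvg_cst.
apply: (@le_lt_trans _ _ 0%E); last exact: ltry.
apply/ess_supP; apply: (nearW ae_filter) => x /=; rewrite patchE.
by case: ifP => _; rewrite ?rnorm0.
Qed.

Definition Linf_pred : {pred R -> X} := [pred u | `[< is_Linf u >]].

Fact Linf_pred_closed : submod_closed Linf_pred.
Proof.
split=> [|a u v /asboolP Lu /asboolP Lv]; apply/asboolP.
  exact: is_Linf0.
exact: is_Linf_lin.
Qed.

HB.instance Definition _ :=
  GRing.isSubmodClosed.Build _ _ Linf_pred Linf_pred_closed.

Record LinfFun := MkLinfFun {
  LinfFun_val :> R -> X;
  LinfFun_valP : LinfFun_val \in Linf_pred }.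

HB.instance Definition _ := [isSub for LinfFun_val].
HB.instance Definition _ := [Choice of LinfFun by <:].
HB.instance Definition _ := [SubChoice_isSubLmodule of LinfFun by <:].

Definition Linf_null : {pred LinfFun} :=
  [pred u : LinfFun | `[< \forall x \ae mu, Rp x -> u x = 0 >]].

Fact Linf_null_closed : zmod_closed Linf_null.
Proof.
split=> [|u v /asboolP u0 /asboolP v0]; apply/asboolP.
  by apply: (nearW ae_filter) => x _.
apply: (filterS2 ae_filter _ u0 v0) => x u0x v0x Rpx.
by rewrite -[RHS](subrr 0) -{1}(u0x Rpx) -(v0x Rpx).
Qed.

HB.instance Definition _ :=
  GRing.isZmodClosed.Build _ Linf_null Linf_null_closed.

(* L^oo(R_+, X): essentially bounded functions modulo equality almost
   everywhere on R_+, with the essential supremum norm [Linf_norm] below. *)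
Definition Linf := Quotient.quot Linf_null.

HB.instance Definition _ := Choice.on Linf.
HB.instance Definition _ := EqQuotient.on Linf.
HB.instance Definition _ := GRing.Zmodule.on Linf.

Definition Linf_repr (u : Linf) : R -> X := LinfFun_val (repr u).

Lemma Linf_piP (u v : LinfFun) :
  \pi_(Linf) u = \pi_(Linf) v <-> \forall x \ae mu, Rp x -> u x = v x.
Proof.
have -> : (\pi_(Linf) u = \pi_(Linf) v) <-> (u - v \in Linf_null).
  by rewrite Quotient.idealrBE; split=> [->|/eqP].
split=> [/asboolP uv|uv].
  apply: (aeS _ uv) => x uvx Rpx.
  by apply/eqP; rewrite -subr_eq0; apply/eqP; exact: uvx.
apply/asboolP; apply: (aeS _ uv) => x uvx Rpx.
by have := uvx Rpx => /= uvx'; rewrite /= -[RHS](subrr (v x)) -{1}uvx'.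
Qed.

Lemma Linf_repr_pi (u : LinfFun) :
  \forall x \ae mu, Rp x -> Linf_repr (\pi_(Linf) u) x = u x.
Proof. by apply/Linf_piP; rewrite reprK. Qed.

Lemma Linf_eqP (u v : Linf) :
  u = v <-> \forall x \ae mu, Rp x -> Linf_repr u x = Linf_repr v x.
Proof. by rewrite -Linf_piP !reprK. Qed.

Definition Linf_scale (a : base_field R c) (u : Linf) : Linf :=
  \pi_(Linf) (a *: repr u).

Lemma Linf_reprZ a u : \forall x \ae mu, Rp x ->
  Linf_repr (Linf_scale a u) x = a *: Linf_repr u x.
Proof. exact: Linf_repr_pi. Qed.

Lemma Linf_reprD (u v : Linf) : \forall x \ae mu, Rp x ->
  Linf_repr (u + v) x = Linf_repr u x + Linf_repr v x.
Proof.
have -> : u + v = \pi_(Linf) (repr u + repr v).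
  by rewrite -{1}[u]reprK -{1}[v]reprK; symmetry; exact: Quotient.pi_add.
exact: Linf_repr_pi.
Qed.

Fact Linf_scaleA a b u : Linf_scale a (Linf_scale b u) = Linf_scale (a * b) u.
Proof.
apply/Linf_eqP.
apply: (filterS3 ae_filter _ (Linf_reprZ a (Linf_scale b u)) (Linf_reprZ b u)
  (Linf_reprZ (a * b) u)) => x Ha Hb Hab Rpx.
by rewrite Ha // Hb // Hab // scalerA.
Qed.

Fact Linf_scale1 : left_id 1 Linf_scale.
Proof.
move=> u; apply/Linf_eqP; apply: (aeS _ (Linf_reprZ 1 u)).
by move=> x H Rpx; rewrite H // scale1r.
Qed.

Fact Linf_scaleDr : right_distributive Linf_scale +%R.
Proof.
move=> a u v; apply/Linf_eqP.
apply: (filterS3 ae_filter _ (Linf_reprZ a (u + v)) (Linf_reprD u v)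
  (aeI (Linf_reprD (Linf_scale a u) (Linf_scale a v))
    (aeI (Linf_reprZ a u) (Linf_reprZ a v)))) => x H1 H2 [H3 [H4 H5]] Rpx.
by rewrite H1 // H2 // H3 // H4 // H5 // scalerDr.
Qed.

Fact Linf_scaleDl u : {morph Linf_scale^~ u : a b / a + b}.
Proof.
move=> a b; apply/Linf_eqP.
apply: (filterS3 ae_filter _ (Linf_reprZ (a + b) u)
  (Linf_reprD (Linf_scale a u) (Linf_scale b u))
  (aeI (Linf_reprZ a u) (Linf_reprZ b u))) => x H1 H2 [H3 H4] Rpx.
by rewrite H1 // H2 // H3 // H4 // scalerDl.
Qed.

HB.instance Definition _ := GRing.Zmodule_isLmodule.Build (base_field R c) Linf
  Linf_scaleA Linf_scale1 Linf_scaleDr Linf_scaleDl.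

Definition Linf_norm (u : Linf) : base_field R c :=
  of_real c (fine (ess_norm Rp (Linf_repr u))).

Lemma ess_norm_Linf (u : Linf) :
  ess_norm Rp (Linf_repr u) = (fine (ess_norm Rp (Linf_repr u)))%:E.
Proof.
rewrite fineK // ge0_fin_numE; last exact: ess_norm_ge0.
by have /asboolP[] := LinfFun_valP (repr u).
Qed.

Lemma eq_ess_norm (u v : R -> X) : (\forall x \ae mu, Rp x -> u x = v x) ->
  ess_norm Rp u = ess_norm Rp v.
Proof.
move=> uv; apply: eq_ess_sup; apply: (aeS _ uv) => x uvx /=.
rewrite !patchE; case: ifPn => // xD; rewrite uvx //; exact: set_mem.
Qed.

Lemma ess_normP (u : R -> X) (M : R) : 0 <= M ->
  (ess_norm Rp u <= M%:E)%E <-> \forall x \ae mu, Rp x -> rnorm (u x) <= M.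
Proof.
move=> M0; split=> [/ess_supP uM|uM].
  apply: (aeS _ uM) => x /= + Rpx.
  by rewrite patchE mem_set // lee_fin.
apply/ess_supP; apply: (aeS _ uM) => x uMx /=; rewrite lee_fin patchE.
by case: ifPn => // /set_mem; exact: uMx.
Qed.

Lemma Linf_norm_ub (u : Linf) :
  \forall x \ae mu, Rp x -> rnorm (Linf_repr u x) <=
    fine (ess_norm Rp (Linf_repr u)).
Proof.
apply/ess_normP; last by rewrite -ess_norm_Linf.
exact/fine_ge0/ess_norm_ge0.
Qed.

Fact Linf_normD (u v : Linf) :
  Linf_norm (u + v) <= Linf_norm u + Linf_norm v.
Proof.
rewrite /Linf_norm -of_realD of_real_le -lee_fin -ess_norm_Linf.
apply/ess_normP; first by rewrite addr_ge0 // fine_ge0 // ess_norm_ge0.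
apply: (filterS3 ae_filter _ (Linf_reprD u v) (Linf_norm_ub u)
  (Linf_norm_ub v)) => x uv ux vx Rpx.
by rewrite uv //; apply: (le_trans (rnormD _ _)); rewrite lerD ?ux ?vx.
Qed.

Lemma Linf_norm_le a (u : Linf) :
  fine (ess_norm Rp (Linf_repr (a *: u))) <=
    re_part `|a| * fine (ess_norm Rp (Linf_repr u)).
Proof.
rewrite -lee_fin -ess_norm_Linf; apply/ess_normP.
  by rewrite mulr_ge0 ?re_part_ge0 // fine_ge0 // ess_norm_ge0.
apply: (filterS2 ae_filter _ (Linf_reprZ a u) (Linf_norm_ub u)) => x au ux Rpx.
by rewrite au // rnormZ ler_wpM2l ?re_part_ge0 ?ux.
Qed.

Fact Linf_normZ a (u : Linf) : Linf_norm (a *: u) = `|a| * Linf_norm u.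
Proof.
rewrite /Linf_norm -[X in X * _]re_partK // -of_realM; congr of_real.
apply/eqP; rewrite eq_le Linf_norm_le /=.
have [->|a0] := eqVneq a 0.
  rewrite normr0 -(of_real0 (c := c)) of_realK mul0r.
  by rewrite fine_ge0 // ess_norm_ge0.
have na0 : 0 < re_part `|a|.
  rewrite lt_neqAle re_part_ge0 // andbT eq_sym; apply: contra a0 => /eqP na.
  by rewrite -normr_eq0 -(re_partK (normr_ge0 a)) na of_real0.
rewrite -ler_pdivlMl //; have := Linf_norm_le a^-1 (a *: u).
rewrite scalerA mulVf // scale1r normfV.
suff -> : re_part `|a|^-1 = (re_part `|a|)^-1 by [].
apply: (mulfI (lt0r_neq0 na0)); rewrite divff ?gt_eqF //.
apply: (@of_real_inj R c); rewrite of_realM !re_partK ?invr_ge0 //.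
rewrite divff ?normr_eq0 //; by case: (c).
Qed.

Fact Linf_norm_eq0 (u : Linf) : Linf_norm u = 0 -> u = 0.
Proof.
move=> u0; have := Linf_norm_ub u; rewrite (_ : fine _ = 0); last first.
  by apply: (@of_real_inj R c); rewrite of_real0.
move=> ux; rewrite -[u]reprK -[0]reprK; apply/Linf_piP.
have z0 : \forall x \ae mu, Rp x -> Linf_repr 0 x = 0.
  by have := Linf_repr_pi 0; rewrite (_ : \pi_(Linf) 0 = 0) // piE.
apply: (filterS2 ae_filter _ ux z0) => x uxx zx Rpx; rewrite [RHS]zx //=.
by apply/rnorm_eq0/eqP; rewrite eq_le rnorm_ge0 uxx.
Qed.

HB.instance Definition _ := Lmodule_isNormed.Build (base_field R c) Linf
  Linf_normD Linf_normZ Linf_norm_eq0.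

End Linf_fun.

Section semigroup.
Context {R : realType} {c : field_kind}.
Local Notation K := (base_field R c).

Definition bounded_operator (X Y : normedModType K) (L : X -> Y) :=
  linear L /\ continuous L.

(* Only the values at nonnegative times are relevant. *)
Definition C0_semigroup (X : normedModType K) (T : R -> X -> X) :=
  [/\ forall t, 0 <= t -> bounded_operator (T t),
      forall x, T 0 x = x,
      forall s t x, 0 <= s -> 0 <= t -> T (s + t) x = T s (T t x) &
      forall x, T t x @[t --> 0^'+] --> x].

(* The unbounded operator with domain [DA] acting as [A] on it. *)
Definition generates (X : normedModType K) (DA : set X) (A : X -> X)
    (T : R -> X -> X) :=
  (forall x, DA x <->
     exists y : X, (of_real c h)^-1 *: (T h x - x) @[h --> 0^'+] --> y) /\
  (forall x, DA x ->
     (of_real c h)^-1 *: (T h x - x) @[h --> 0^'+] --> A x).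

(* [J] is a bounded inverse of [aI - A]; that is, [a] is in the resolvent
   set of [A] and [J] is the resolvent at [a]. *)
Definition is_resolvent (X : normedModType K) (DA : set X) (A : X -> X)
    (a : K) (J : X -> X) :=
  [/\ bounded_operator J,
      forall x, DA (J x) /\ a *: J x - A (J x) = x &
      forall x, DA x -> J (a *: x - A x) = x].

(* The completion of [X] for the norm [x |-> |J x|], given by its canonical
   embedding [i]; it is determined up to isometric isomorphism. *)
Definition is_completion (X : normedModType K) (J : X -> X)
    (Xm1 : completeNormedModType K) (i : X -> Xm1) :=
  [/\ linear i, forall x, `|i x| = `|J x| & dense (range i)].

Definition extends_semigroup (X Xm1 : normedModType K) (i : X -> Xm1)
    (T : R -> X -> X) (Tm1 : R -> Xm1 -> Xm1) :=
  C0_semigroup Tm1 /\ forall t x, 0 <= t -> Tm1 t (i x) = i (T t x).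

End semigroup.

Section admissibility.
Context {R : realType} {c : field_kind}.
Local Notation K := (base_field R c).
Variables (X Xm1 W : normedModType K) (i : X -> Xm1) (Tm1 : R -> Xm1 -> Xm1).
Variable B : W -> Xm1.

(* The Bochner integral over [0, t] of [T_{-1}(t - s) B u(s)] exists and
   equals [z]. *)
Definition is_convolution (t : R) (u : R -> W) (z : Xm1) :=
  is_bochner_integral `[0, t]%classic (fun s => Tm1 (t - s) (B (u s))) z.

Definition infty_admissible :=
  exists2 t : R, 0 < t &
    forall u, is_Linf_loc u -> exists y : X, is_convolution t u (i y).

Definition zero_class_admissible :=
  exists h : R -> R,
    [/\ forall t, 0 < t -> 0 < h t,
        forall s t, 0 < s -> s <= t -> h s <= h t,
        forall (t : R) u, 0 < t -> is_Linf_loc u ->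
          exists2 y : X, is_convolution t u (i y) &
            rnorm y <= h t * fine (ess_norm `[0, t]%classic u) &
        h t @[t --> 0^'+] --> (0 : R)].

(* The value in [X] of the convolution integral (0 if there is none). *)
Definition input_map (t : R) (u : R -> W) : X :=
  xget 0 [set y | is_convolution t u (i y)].

Definition input_map_continuous :=
  {within [set p : R * Linf W | 0 <= p.1],
    continuous (fun p : R * Linf W => input_map p.1 (Linf_repr p.2))}.

End admissibility.

Section mild_solutions.
Context {R : realType} {c : field_kind}.
Local Notation K := (base_field R c).
Variables (X U V Xm1 : normedModType K) (i : X -> Xm1).
Variables (T : R -> X -> X) (Tm1 : R -> Xm1 -> Xm1).
Variables (B : U -> Xm1) (B2 : V -> Xm1) (f : X * U -> V).
Variables (x0 : X) (u : R -> U).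

Definition mild_solution_on (tau : R) (x : R -> X) :=
  {within `[0, tau]%classic, continuous x} /\
  forall t, 0 <= t <= tau -> exists z2 z,
    [/\ is_convolution Tm1 B2 t (fun s => f (x s, u s)) z2,
        is_convolution Tm1 B t u z &
        i (x t) = i (T t x0) + z2 + z].

(* A function on [0, t1) is represented by [x : R -> X], whose values
   outside [0, t1) are irrelevant. *)
Definition mild_solution (t1 : \bar R) (x : R -> X) :=
  (0 < t1)%E /\
  forall tau : R, 0 < tau -> (tau%:E < t1)%E -> mild_solution_on tau x.

Definition agree_before (t1 : \bar R) (x1 x2 : R -> X) :=
  forall t, 0 <= t -> (t%:E < t1)%E -> x2 t = x1 t.

Definition extends_solution (t1 t2 : \bar R) (x1 x2 : R -> X) :=
  (t1 < t2)%E /\ agree_before t1 x1 x2.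

Definition maximal_mild_solution (t1 : \bar R) (x1 : R -> X) :=
  mild_solution t1 x1 /\
  forall t2 x2, mild_solution t2 x2 -> ~ extends_solution t1 t2 x1 x2.

Definition unique_maximal_mild_solution :=
  exists t1 x1, maximal_mild_solution t1 x1 /\
    forall t2 x2, maximal_mild_solution t2 x2 ->
      t2 = t1 /\ agree_before t1 x1 x2.

End mild_solutions.

Section control_systems.
Context {R : realType} {c : field_kind}.
Local Notation K := (base_field R c).

(* Agreement of two inputs on [D] up to a set in [N].  [N = [set set0]] gives
   pointwise agreement; for spaces whose elements are functions modulo
   equality almost everywhere, [N] is the class of negligible sets. *)
Definition agree_on (N : set (set R)) (U : Type) (D : set R) (u v : R -> U) :=
  exists2 E, N E & forall s, D s -> ~ E s -> u s = v s.

Definition shift_input (U : Type) (tau : R) (u : R -> U) : R -> U :=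
  fun s => u (s + tau).

Definition concat_inputs (U : Type) (t : R) (u1 u2 : R -> U) : R -> U :=
  fun s => if s <= t then u1 s else u2 (s - t).

(* The elements of the normed space [UU] are functions R_+ -> U: the map
   [ev] sends each of them to (a representative of) that function. *)
Record input_space (N : set (set R)) (U UU : normedModType K)
    (ev : UU -> R -> U) : Prop := InputSpace {
  input_linear : forall (a : K) u v,
    agree_on N `[0, +oo[%classic (ev (a *: u + v)) (a *: ev u + ev v);
  input_inj : forall u v,
    agree_on N `[0, +oo[%classic (ev u) (ev v) -> u = v;
  input_shift : forall u tau, 0 <= tau ->
    exists2 v, agree_on N `[0, +oo[%classic (ev v) (shift_input tau (ev u)) &
      `|v| <= `|u|;
  input_concat : forall u1 u2 t, 0 < t ->
    exists v, agree_on N `[0, +oo[%classic (ev v) (concat_inputs t (ev u1) (ev u2))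
}.

(* [phi] is only relevant on the domain [D]. *)
Record control_system (N : set (set R)) (X U UU : normedModType K)
    (ev : UU -> R -> U) (D : set (R * X * UU)) (phi : R -> X -> UU -> X)
    : Prop := ControlSystem {
  cs_input : input_space N ev;
  cs_domain : forall x u, exists2 tm : \bar R, (0 < tm)%E &
    forall t, D (t, x, u) <-> 0 <= t /\ (t%:E < tm)%E;
  cs_identity : forall x u, phi 0 x u = x;
  cs_causality : forall t x u v, D (t, x, u) ->
    agree_on N `[0, t]%classic (ev u) (ev v) ->
    (forall s, 0 <= s <= t -> D (s, x, v)) /\ phi t x u = phi t x v;
  cs_continuity : forall x u,
    {within [set t | D (t, x, u)], continuous (fun t => phi t x u)};
  cs_cocycle : forall x u t h, 0 <= t -> 0 <= h ->
    (forall s, 0 <= s <= t + h -> D (s, x, u)) ->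
    forall v, agree_on N `[0, +oo[%classic (ev v) (shift_input t (ev u)) ->
      D (h, phi t x u, v) /\ phi h (phi t x u) v = phi (t + h) x u
}.

End control_systems.

(* Main.v *)
(* Mild solutions obey the splitting of the Bochner integral
     int_0^{t+h} T_{-1}(t+h-s) w(s) ds
       = T_{-1}(h) int_0^t T_{-1}(t-s) w(s) ds + int_0^h T_{-1}(h-s) w(t+s) ds,
   so they can be restarted at time t with the shifted input, and glued to a
   solution starting at x(t).  By Zorn's lemma every mild solution is the
   restriction of a maximal one, hence, by well-posedness, of phi.  Restarting
   gives the cocycle property.  For causality, phi(.,x,u) on [0,t] is a mild
   solution for any input equal to u on [0,t]; gluing a solution starting at
   phi(t,x,u) shows that the maximal solution for that input lives beyond t and
   agrees with phi(.,x,u) up to t. *)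
Require Import Defs.
From HB Require Import structures.
From mathcomp Require Import all_boot all_order all_algebra.
From mathcomp Require Import all_classical all_reals all_analysis measurable_realfun.

Set Implicit Arguments.
Unset Strict Implicit.
Unset Printing Implicit Defensive.

Import Order.TTheory GRing.Theory Num.Theory.
Import numFieldNormedType.Exports.

Local Open Scope classical_set_scope.
Local Open Scope ring_scope.

(** * Translation invariance of Lebesgue measure, and comparison of lower integrals *)

Section lebesgue_translation.
Context {R : realType}.
Local Notation mu := (@lebesgue_measure R).
Local Notation RT := (measurableTypeR R).

Import HBNNSimple.

Lemma measurable_addr (t : R) : measurable_fun setT (fun x : RT => x + t : RT).
Proof. exact: (@measurable_funD _ RT R setT id (cst t)). Qed.

Lemma measurable_preimage_addr (t : R) (A : set RT) :
  measurable A -> measurable ((fun x : R => x + t) @^-1` A : set RT).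
Proof. by move=> mA; rewrite -[X in measurable X]setTI; exact: measurable_addr. Qed.

(** The push-forward of [mu] under the translation gives every half-open interval its length, and
    Lebesgue measure is the only measure doing so. *)
Lemma lebesgue_measure_addr (t : R) (A : set RT) : measurable A ->
  mu ((fun x => x + t) @^-1` A) = mu A.
Proof.
pose M := isMeasurableFun.Build _ _ _ _ _ (measurable_addr t).
pose f : {mfun RT >-> RT} := HB.pack (fun x : RT => x + t : RT) M.
move=> mA; apply/esym.
apply: (lebesgue_measure_unique (mu := pushforward mu f)) => //.
move=> _ [[a b]] _ <-.
rewrite -[RHS]/(mu (f @^-1` `]a, b]%classic)).
have -> : f @^-1` `]a, b]%classic = `](a - t), (b - t)]%classic.
  by apply/seteqP; split=> x /=; rewrite !in_itv /= ltrBlDr lerBrDr.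
rewrite !lebesgue_measure_itv /= !lte_fin ltrD2r.
by case: ifP => // _; rewrite -!EFinB; congr EFin; rewrite opprB addrA subrK.
Qed.

Lemma negligible_addr (t : R) (A : set RT) :
  mu.-negligible A -> mu.-negligible ((fun x => x + t) @^-1` A).
Proof.
move=> [N [mN N0 AN]]; exists ((fun x => x + t) @^-1` N); split.
- exact: measurable_preimage_addr.
- by rewrite -[RHS]N0; exact: lebesgue_measure_addr.
- by move=> x; exact: AN.
Qed.

Lemma ae_addr (t : R) (P : R -> Prop) :
  (\forall x \ae mu, P x) -> \forall x \ae mu, P (x + t).
Proof. exact: negligible_addr. Qed.

Local Open Scope ereal_scope.

Lemma ge0_integral_addr (t : R) (D : set RT) (G : RT -> \bar R) :
  measurable D -> measurable_fun setT G -> (forall x, 0 <= G x) ->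
  \int[mu]_(x in (fun x => x + t)%R @^-1` D) G (x + t)%R = \int[mu]_(x in D) G x.
Proof.
move=> mD mG G0.
rewrite -(ge0_integral_pushforward (measurable_addr t)) //; last exact: measurable_funTS.
apply: eq_measure_integral; first exact: measurable_addr.
by move=> mt A mA _; exact: lebesgue_measure_addr.
Qed.

(* The integral of a nonmeasurable [g >= 0] is its lower integral. *)
Lemma ae_le_lower_integral (D : set RT) (g G : RT -> \bar R) :
  measurable D -> (forall x, 0 <= g x) -> (forall x, 0 <= G x) ->
  measurable_fun setT G -> (\forall x \ae mu, D x -> g x <= G x) ->
  \int[mu]_(x in D) g x <= \int[mu]_(x in D) G x.
Proof.
move=> mD g0 G0 mG gG; rewrite ge0_integralE //.
apply: ge_ereal_sup => _ [h /= hg <-].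
rewrite -integralT_nnsfun [leRHS]integral_mkcond.
apply: ae_ge0_le_integral => //.
- by move=> x _; rewrite lee_fin; exact: fun_ge0.
- exact/measurable_EFinP/measurable_funP.
- by move=> x _; rewrite patchE; case: ifP.
- exact/(measurable_restrictT _ mD)/measurable_funTS.
apply: filterS gG => x gG _; apply: (le_trans (hg x)).
by rewrite !patchE; case: ifPn => // /set_mem; exact: gG.
Qed.

(** No measurability enters: a simple function below [g] on [D] is also below [G], so the supremum
    defining the right-hand side runs over a larger set. *)
Lemma ge0_le_lower_integral (D : set RT) (g G : RT -> \bar R) :
  (forall x, 0 <= g x) -> (forall x, g x <= G x) ->
  \int[mu]_(x in D) g x <= \int[mu]_(x in D) G x.
Proof.
move=> g0 gG; have G0 x : 0 <= G x by exact: le_trans (gG x).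
rewrite !ge0_integralE //; apply: ge_ereal_sup => _ [h /= hg <-].
apply: ereal_sup_ubound; exists h => //= x; apply: (le_trans (hg x)).
by rewrite !patchE; case: ifP.
Qed.

End lebesgue_translation.

(** * Convergence and continuity in terms of the real-valued norm *)

Section rnorm_topology.
Context {R : realType} {c : field_kind} {X : normedModType (base_field R c)}.
Implicit Types x y : X.

Lemma of_real_lt (r s : R) : (of_real c r < of_real c s) = (r < s).
Proof. by rewrite !lt_neqAle of_real_le (inj_eq (@of_real_inj R c)). Qed.

Lemma of_real_sum (I : Type) (r : seq I) (P : pred I) (F : I -> R) :
  of_real c (\sum_(j <- r | P j) F j) = \sum_(j <- r | P j) of_real c (F j).
Proof. exact: (big_morph _ (@of_realD R c) (of_real0 (c := c))). Qed.

Lemma rnormN x : rnorm (- x) = rnorm x.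
Proof. by rewrite /rnorm normrN. Qed.

Lemma rnormB x y : rnorm (x - y) = rnorm (y - x).
Proof. by rewrite -rnormN opprB. Qed.

Lemma rnorm_lt x (r : R) : (`|x| < of_real c r) = (rnorm x < r).
Proof. by rewrite rnormE of_real_lt. Qed.

Lemma rnormZ_real (r : R) x : 0 <= r -> rnorm (of_real c r *: x) = r * rnorm x.
Proof.
move=> r0; rewrite rnormZ ger0_norm ?of_realK //.
by rewrite -(of_real0 (c := c)) of_real_le.
Qed.

(** The positive elements of the scalar field, real or complex, are exactly the images of positive
    reals, so testing against real [e] suffices. *)
Lemma rnorm_cvgP (T : Type) (F : set_system T) {FF : Filter F} (f : T -> X) y :
  f @ F --> y <-> forall e : R, 0 < e -> \forall t \near F, rnorm (y - f t) < e.
Proof.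
split=> [/cvgrPdist_lt fy e e0|fy].
  have e0' : 0 < of_real c e by rewrite -(of_real0 (c := c)) of_real_lt.
  by apply: filterS (fy _ e0') => t; rewrite rnorm_lt.
apply/cvgrPdist_lt => e e0; have eE := re_partK (ltW e0).
move: e0; rewrite -eE -{1}(of_real0 (c := c)) of_real_lt => /fy.
by apply: filterS => t; rewrite rnorm_lt.
Qed.

Lemma rnorm_cvg0P (T : Type) (F : set_system T) {FF : Filter F} (f : T -> X) y :
  f @ F --> y <-> rnorm (y - f t) @[t --> F] --> (0 : R).
Proof.
rewrite rnorm_cvgP; split=> [fy|/cvgrPdist_lt fy].
  apply/cvgrPdist_lt => e /fy; apply: filterS => t.
  by rewrite sub0r normrN ger0_norm // rnorm_ge0.
move=> e /fy; apply: filterS => t.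
by rewrite sub0r normrN ger0_norm // rnorm_ge0.
Qed.

Lemma ler_rnorm_dist x y : `|rnorm x - rnorm y| <= rnorm (x - y).
Proof.
have H a b : rnorm a <= rnorm b + rnorm (a - b).
  by apply: le_trans (rnormD _ _); rewrite addrC subrK.
rewrite ler_distl lerBlDr H andbT rnormB; exact: H.
Qed.

Lemma cvg_rnorm (T : Type) (F : set_system T) {FF : Filter F} (f : T -> X) y :
  f @ F --> y -> rnorm (f t) @[t --> F] --> rnorm y.
Proof.
move=> /rnorm_cvgP fy; apply/cvgrPdist_lt => e /fy; apply: filterS => t.
exact/le_lt_trans/ler_rnorm_dist.
Qed.

End rnorm_topology.

(** * Integrals of simple functions *)

Section simple_integration.
Context {R : realType} {c : field_kind} {X : normedModType (base_field R c)}.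
Local Notation mu := (@lebesgue_measure R).
Local Notation RT := (measurableTypeR R).

Lemma simple_fun_seq (s : R -> X) : simple_fun s ->
  exists2 A : seq X, uniq A & forall x, s x \in A.
Proof.
move=> [/finite_seqP[A sA] _]; exists (undup A); first exact: undup_uniq.
move=> x; rewrite mem_undup; have : range s (s x) by exists x.
by rewrite sA.
Qed.

Section indexed.
Variables (I : choiceType) (A : seq I) (q : R -> I).
Hypotheses (uA : uniq A) (qA : forall x, q x \in A).
Hypothesis mq : forall p, measurable (q @^-1` [set p] : set RT).

Lemma measurable_index (P : set I) : measurable (q @^-1` P : set RT).
Proof.
rewrite (_ : _ @^-1` _ = \bigcup_(p in [set` A] `&` P) (q @^-1` [set p])).
  by apply: fin_bigcup_measurable => [|p _]; [exact: finite_setIl|exact: mq].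
apply/seteqP; split=> [x Px|x [p [_ Pp] /= ->]] //; exists (q x) => //.
by split => //=.
Qed.

Lemma measurable_fun_index d (T : measurableType d) (g : I -> T) :
  measurable_fun setT (fun x : RT => g (q x)).
Proof. by move=> _ B _; rewrite setTI; exact: (measurable_index (g @^-1` B)). Qed.

Variables (D : set RT) (mD : measurable D) (finD : (mu D < +oo)%E).

Definition mass (p : I) : R := fine (mu (D `&` q @^-1` [set p])).

Lemma mass_ge0 p : 0 <= mass p.
Proof. exact: fine_ge0. Qed.

Lemma finite_massE (S : set RT) : measurable S ->
  mu (D `&` S) = (fine (mu (D `&` S)))%:E.
Proof.
move=> mS; rewrite fineK // ge0_fin_numE //.
by apply: le_lt_trans finD; apply: le_measure; rewrite ?inE //; exact: measurableI.
Qed.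

Lemma mass_preimage (P : pred I) :
  fine (mu (D `&` q @^-1` [set` P])) = \sum_(p <- A | P p) mass p.
Proof.
have -> : D `&` q @^-1` [set` P] =
    \bigcup_(p in [set` seq.filter P A]) (D `&` q @^-1` [set p]).
  apply/seteqP; split=> [x [Dx Px]|x [p + [Dx /= qx]]]; last first.
    by rewrite /= mem_filter => /andP[Px _]; split => //=; rewrite qx.
  by exists (q x) => //=; rewrite mem_filter qA andbT.
rewrite measure_fin_bigcup //=.
- rewrite -(fsbig_seq _ _ (filter_uniq _ uA)) big_filter.
  under eq_bigr do rewrite finite_massE //.
  by rewrite sumEFin.
- by move=> p p' _ _ [x [[_ /= xp] [_ /= xp']]]; rewrite -xp -xp'.
- by move=> p _; exact: measurableI.
Qed.

(** The integral can be computed over any finite index through which the function factors, even when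
    [phi] is not injective. Several simple functions can thus be integrated over one common index,
    which turns linearity into an identity of finite sums. *)
Lemma simple_integralE (phi : I -> X) :
  simple_integral D (phi \o q) = \sum_(p <- A) of_real c (mass p) *: phi p.
Proof.
rewrite /simple_integral (fsbig_fwiden (undup (map phi A))); first last.
- move=> v [_ /= nv].
  rewrite (_ : _ `&` _ = set0) ?measure0 ?of_real0 ?scale0r //.
  by apply/seteqP; split=> x //= -[_ xv]; case: nv; exists x.
- exact: undup_uniq.
- by move=> _ [x _ <-] /=; rewrite mem_undup map_f.
transitivity (\sum_(v <- undup (map phi A)) \sum_(p <- A | phi p == v)
    of_real c (mass p) *: phi p).
  (* The fibre over the value [v] is the disjoint union of the fibres of [q] over the indices [p]
     with [phi p == v]; exchanging the two sums afterwards leaves each [p] counted once. *)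
  apply: eq_bigr => v _; rewrite (_ : _ @^-1` _ = q @^-1` [set` [pred p | phi p == v]]).
    rewrite mass_preimage of_real_sum scaler_suml.
    by apply: eq_bigr => p /eqP ->.
  by apply/seteqP; split=> x /= /eqP.
rewrite (exchange_big_dep xpredT) //=; apply: eq_big_seq => p pA.
rewrite big_mkcond (bigD1_seq (phi p)) ?mem_undup ?map_f ?undup_uniq //= eqxx.
by rewrite big1 ?addr0 // => v; rewrite eq_sym => /negbTE ->.
Qed.

Lemma integral_index (g : I -> R) : (forall p, 0 <= g p) ->
  (\int[mu]_(x in D) (g (q x))%:E = (\sum_(p <- A) mass p * g p)%:E)%E.
Proof.
move=> g0.
transitivity (\int[mu]_(x in D)
    \sum_(p <- A) ((g p)%:E * (\1_(q @^-1` [set p]) x)%:E))%E.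
  apply: eq_integral => x _; rewrite (bigD1_seq (q x)) //= big1 => [|p pq].
    by rewrite adde0 indicE mem_set ?mule1.
  rewrite indicE memNset ?mule0 //= => pq'; by rewrite pq' eqxx in pq.
rewrite ge0_integral_sum //; last 2 first.
- move=> p; apply: emeasurable_funM => //.
  by apply/measurable_EFinP; exact: measurable_indic.
- by move=> p x _; rewrite -EFinM lee_fin mulr_ge0.
rewrite -sumEFin; apply: eq_bigr => p _; rewrite ge0_integralZl_EFin //.
- rewrite integral_indic // setIC.
  by rewrite EFinM muleC /mass -finite_massE //; exact: mq.
- by apply/measurable_EFinP; exact: measurable_indic.
Qed.

Lemma rnorm_simple_integral_le (phi : I -> X) :
  ((rnorm (simple_integral D (phi \o q)))%:E <=
     \int[mu]_(x in D) (rnorm (phi (q x)))%:E)%E.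
Proof.
rewrite (integral_index (g := fun p => rnorm (phi p))) => [|p]; last exact: rnorm_ge0.
rewrite lee_fin simple_integralE.
elim/big_ind2: _ => [|x r y s xr ys|p _]; first by rewrite rnorm0.
  by rewrite (le_trans (rnormD _ _)) // lerD.
by rewrite rnormZ_real // mass_ge0.
Qed.

End indexed.
End simple_integration.

Lemma simple_fun_if (R : realType) (c : field_kind)
    (X : normedModType (base_field R c)) (b : R -> bool) (s r : R -> X) :
  measurable ([set` b] : set (measurableTypeR R)) -> simple_fun s -> simple_fun r ->
  simple_fun (fun x => if b x then s x else r x).
Proof.
move=> mb [fs ms] [fr mr]; split.
  apply: (@sub_finite_set _ _ (range s `|` range r)); last by rewrite finite_setU.
  by move=> _ [x _ <-]; case: ifP => _; [left|right]; exists x.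
move=> v; rewrite (_ : _ @^-1` _ = ([set` b] `&` s @^-1` [set v]) `|`
    (~` [set` b] `&` r @^-1` [set v])).
  by apply: measurableU; apply: measurableI => //; exact: measurableC.
apply/seteqP; split=> x /=; first by case: ifPn => [|/negP]; [left|right].
rewrite -[b x]/(x \in b).
by move=> [[bx <-]|[/negP/negbTE bx <-]]; rewrite bx.
Qed.

Lemma simple_fun_addr (R : realType) (c : field_kind)
    (X : normedModType (base_field R c)) (t : R) (s : R -> X) :
  simple_fun s -> simple_fun (fun x => s (x + t)).
Proof.
move=> [fs ms]; split; first by apply: sub_finite_set fs => _ [x _ <-]; exists (x + t).
by move=> v; exact: (measurable_preimage_addr t (ms v)).
Qed.

(** * Bochner integrals: independence of the approximation, bounded operators, translation, unions
    and differences of domains *)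

Section bochner_theory.
Context {R : realType} {c : field_kind}.
Local Notation K := (base_field R c).
Local Notation mu := (@lebesgue_measure R).
Local Notation RT := (measurableTypeR R).
Implicit Types (X Y : normedModType K) (D : set RT).

Let ae_filter : Filter (almost_everywhere mu) := ae_filter_ringOfSetsType mu.

Lemma measurable_rnorm_simple X (s r : R -> X) : simple_fun s -> simple_fun r ->
  measurable_fun setT (fun x : RT => (rnorm (s x - r x))%:E).
Proof.
move=> ss sr; apply/measurable_EFinP.
have [A _ sA] := simple_fun_seq (simple_funP (fun x y => x - y) ss sr).
apply: (measurable_fun_index sA _ (fun v : X => rnorm v)).
by case: (simple_funP (fun x y => x - y) ss sr).
Qed.

Section simple_integral_theory.
Context {X : normedModType K}.
Variables (D : set RT) (mD : measurable D) (finD : (mu D < +oo)%E).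

Lemma simple_integralB (s r : R -> X) : simple_fun s -> simple_fun r ->
  simple_integral D (fun x => s x - r x) = simple_integral D s - simple_integral D r.
Proof.
move=> ss sr; have [A uA sA] := simple_fun_seq ss; have [B uB rB] := simple_fun_seq sr.
(* The pair of values is a common index for [s], [r] and their difference. *)
pose q x := (s x, r x); pose AB := [seq (v, w) | v <- A, w <- B].
have qAB x : q x \in AB by exact: allpairs_f.
have uAB : uniq AB by apply: allpairs_uniq => // -[? ?] [? ?] _ _ [-> ->].
have mq p : measurable (q @^-1` [set p] : set RT).
  rewrite (_ : _ @^-1` _ = s @^-1` [set p.1] `&` r @^-1` [set p.2]).
    by apply: measurableI; [case: ss|case: sr].
  by case: p => v w; apply/seteqP; split=> x /= [<- <-].
have E := simple_integralE (X := X) uAB qAB mq mD finD.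
have /= Es := E (fun p => p.1); have /= Er := E (fun p => p.2).
rewrite [LHS](E (fun p => p.1 - p.2)) [simple_integral D s]Es [simple_integral D r]Er.
by rewrite -sumrB; apply: eq_bigr => p _; rewrite scalerBr.
Qed.

Lemma simple_integralBE (s r : R -> X) : simple_fun s -> simple_fun r ->
  ((rnorm (simple_integral D s - simple_integral D r))%:E <=
    \int[mu]_(x in D) (rnorm (s x - r x))%:E)%E.
Proof.
move=> ss sr; rewrite -simple_integralB //.
have ssr := simple_funP (fun x y => x - y) ss sr.
have [A uA sA] := simple_fun_seq ssr.
by apply: (rnorm_simple_integral_le uA sA _ mD finD id); case: ssr.
Qed.

Lemma simple_integral_ae_eq (s r : R -> X) : simple_fun s -> simple_fun r ->
  (\forall x \ae mu, D x -> s x = r x) ->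
  simple_integral D s = simple_integral D r.
Proof.
move=> ss sr sr_eq; apply/eqP; rewrite -subr_eq0; apply/eqP/rnorm_eq0/eqP.
rewrite eq_le rnorm_ge0 andbT -lee_fin.
apply: (le_trans (simple_integralBE ss sr)).
apply: (@le_trans _ _ (\int[mu]_(x in D) cst 0%E x)%E); last by rewrite integral0.
apply: ae_ge0_le_integral => //.
- by move=> x _; rewrite lee_fin rnorm_ge0.
- by apply: measurable_funTS; exact: measurable_rnorm_simple.
- apply: filterS sr_eq => x srx /srx ->.
  by rewrite subrr rnorm0.
Qed.

Lemma simple_integral_linear Y (L : X -> Y) (s : R -> X) :
  linear L -> simple_fun s ->
  simple_integral D (L \o s) = L (simple_integral D s).
Proof.
move=> linL ss; have [A uA sA] := simple_fun_seq ss; have [_ ms] := ss.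
pose L' : {linear X -> Y} := HB.pack L (GRing.isLinear.Build _ _ _ _ L linL).
rewrite (simple_integralE uA sA ms mD finD L).
rewrite (simple_integralE uA sA ms mD finD id).
by rewrite -[L]/(L' : X -> Y) linear_sum; apply: eq_bigr => v _; rewrite linearZ.
Qed.

End simple_integral_theory.

(** The domains need only be disjoint up to a null set, because the intervals [[0, t]] and
    [[t, t + h]] to which this is applied share an endpoint. *)
Lemma simple_integralU X (D1 D2 : set RT) (s : R -> X) :
  measurable D1 -> measurable D2 -> (mu D1 < +oo)%E -> (mu D2 < +oo)%E ->
  mu (D1 `&` D2) = 0%E -> simple_fun s ->
  simple_integral (D1 `|` D2) s = simple_integral D1 s + simple_integral D2 s.
Proof.
move=> mD1 mD2 f1 f2 D120 ss; have [A uA sA] := simple_fun_seq ss.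
have [_ ms] := ss.
have mU : measurable (D1 `|` D2) by exact: measurableU.
have fU : (mu (D1 `|` D2) < +oo)%E.
  by apply: le_lt_trans (measureU2 mu mD1 mD2) _; exact: lte_add_pinfty.
rewrite !(simple_integralE uA sA ms _ _ id) //.
rewrite -big_split /=; apply: eq_bigr => v _.
rewrite -scalerDl -of_realD; congr (of_real c _ *: _).
have mS := ms v; set S := s @^-1` _ in mS *.
rewrite /mass -/S -fineD ?fin_numE; last 2 first.
- by rewrite (finite_massE _ f1).
- by rewrite (finite_massE _ f2).
congr fine; rewrite setIUl measureUfinl //=; last 3 first.
- exact: measurableI.
- exact: measurableI.
- by rewrite (finite_massE _ f1) // ltry.
rewrite (_ : mu (D1 `&` S `&` _) = 0%E) ?sube0 //.
apply/eqP; rewrite -measure_le0 -D120; apply: le_measure; rewrite ?inE.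
- by do 2?apply: measurableI => //; exact: measurableI.
- exact: measurableI.
- by move=> x [[? _] [? _]].
Qed.

(* Replaces the norms [rnorm (f x - s n x)], only almost everywhere equal to a
   Borel function, by Borel majorants. *)
Definition bochner_approx X D (f : R -> X) (s : nat -> R -> X)
    (G : nat -> RT -> \bar R) :=
  [/\ forall n, simple_fun (s n),
      \forall x \ae mu, D x -> s n x @[n --> \oo] --> f x,
      forall n, measurable_fun setT (G n) /\ (forall x, 0 <= G n x)%E,
      forall n, \forall x \ae mu, D x -> ((rnorm (f x - s n x))%:E <= G n x)%E &
      (\int[mu]_(x in D) G n x)%E @[n --> \oo] --> (0 : \bar R)].

(** With Borel majorants of the errors, additivity and monotonicity of the integral become available
    without any measurability assumption on [f]. *)
Lemma bochner_integralP X D (f : R -> X) (y : X) : measurable D ->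
  is_bochner_integral D f y <->
  exists s G, bochner_approx D f s G /\ simple_integral D (s n) @[n --> \oo] --> y.
Proof.
move=> mD; split=> [[s [ss sf sG sy]]|[s [G [[ss sf mG fG G0] sy]]]]; last first.
  exists s; split=> //; apply: (squeeze_cvge _ (cvg_cst 0%E) G0).
  apply: nearW => n; have [mGn Gn0] := mG n; apply/andP; split.
    by apply: integral_ge0 => x _; rewrite lee_fin rnorm_ge0.
  by apply: ae_le_lower_integral => // x; rewrite lee_fin rnorm_ge0.
have [N [mN N0 sN]] := sf.
have sfN x : D x -> ~ N x -> s n x @[n --> \oo] --> f x.
  by move=> Dx; apply: contra_notP => sfx; apply: sN => /(_ Dx).
have mDN : measurable (D `\` N) by exact: measurableD.
(* On [D] and off the null set [N] the error is the pointwise limit, as [m] grows, of the Borel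
   functions [rnorm (s m x - s n x)]; with the value 0 elsewhere it is therefore Borel. *)
pose G n := (fun x : RT => (rnorm (f x - s n x))%:E) \_ (D `\` N).
have G0 n x : (0 <= G n x)%E.
  by rewrite /G patchE; case: ifP => // _; rewrite lee_fin rnorm_ge0.
exists s, G; split=> //; split=> //.
- move=> n; split=> //; apply: (@emeasurable_fun_cvg _ _ _ _
    (fun m => (fun x : RT => (rnorm (s m x - s n x))%:E) \_ (D `\` N))).
    move=> m; apply/(measurable_restrictT _ mDN)/measurable_funTS.
    exact: measurable_rnorm_simple.
  move=> x _; rewrite /G.
  have [/set_mem DNx|DNx] := boolP (x \in D `\` N); last first.
    under eq_fun do rewrite patchE (negbTE DNx).
    by rewrite patchE (negbTE DNx); exact: cvg_cst.
  rewrite patchE mem_set //; under eq_fun do rewrite patchE mem_set //.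
  have [Dx Nx] := DNx; apply/cvg_EFin; first exact: nearW.
  by apply: cvg_rnorm; apply: cvgB; [exact: sfN|exact: cvg_cst].
- move=> n; exists N; split=> // x /= Gx; apply: contrapT => Nx; apply: Gx => Dx.
  by rewrite /G patchE mem_set.
- apply: (squeeze_cvge _ (cvg_cst 0%E) sG); apply: nearW => n; apply/andP; split.
    by apply: integral_ge0 => x _.
  apply: ge0_le_lower_integral => // x; rewrite /G patchE; case: ifP => // _.
  by rewrite lee_fin rnorm_ge0.
Qed.

(** The integral does not depend on the approximating sequence: the distance between the two simple
    integrals is at most the integral of [G n + G' n], which tends to 0. *)
Lemma bochner_approx_cvg X D (f : R -> X) s G s' G' (y : X) :
  measurable D -> (mu D < +oo)%E ->
  bochner_approx D f s G -> bochner_approx D f s' G' ->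
  simple_integral D (s n) @[n --> \oo] --> y ->
  simple_integral D (s' n) @[n --> \oo] --> y.
Proof.
move=> mD fD [ss _ mG sG G0] [ss' _ mG' sG' G'0] sy.
have ss'0 : rnorm (simple_integral D (s n) - simple_integral D (s' n)) @[n --> \oo]
    --> (0 : R).
  suff /fine_cvgP[] : (rnorm (simple_integral D (s n) - simple_integral D (s' n)))%:E
    @[n --> \oo] --> 0%:E by [].
  apply: (squeeze_cvge _ (cvg_cst 0%E)); last first.
    by rewrite -[X in _ --> X]adde0; apply: cvgeD G0 G'0.
  apply: nearW => n; rewrite lee_fin rnorm_ge0 /=.
  have [[mGn Gn] [mGn' Gn']] := (mG n, mG' n).
  apply: le_trans (simple_integralBE mD fD (ss n) (ss' n)) _.
  rewrite -ge0_integralD //; [|exact: measurable_funTS..].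
  apply: ae_ge0_le_integral => //.
  - by move=> x _; rewrite lee_fin rnorm_ge0.
  - by apply: measurable_funTS; exact: measurable_rnorm_simple.
  - by move=> x _; rewrite adde_ge0.
  - by apply: measurable_funTS; apply: emeasurable_funD.
  apply: (filterS2 ae_filter _ (sG n) (sG' n)) => x sGx sGx' Dx.
  apply: le_trans (leeD (sGx Dx) (sGx' Dx)).
  rewrite -EFinD lee_fin (rnormB (f x) (s n x)).
  by apply: le_trans (rnormD _ _); rewrite addrA subrK.
move/rnorm_cvg0P in sy; apply/rnorm_cvg0P.
apply: (squeeze_cvgr _ (cvg_cst 0)); last first.
  by rewrite -[X in _ --> X]addr0; apply: cvgD sy ss'0.
apply: nearW => n /=; rewrite rnorm_ge0 /=.
by apply: le_trans (rnormD _ _); rewrite addrA subrK.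
Qed.

Lemma bounded_operator_rnorm X Y (L : X -> Y) : bounded_operator L ->
  exists2 M : R, 0 <= M & forall x, rnorm (L x) <= M * rnorm x.
Proof.
move=> [linL contL].
pose L' : {linear X -> Y} := HB.pack L (GRing.isLinear.Build _ _ _ _ L linL).
have /linear_boundedP/pinfty_ex_gt0[M M0 LM] : bounded_near L' (nbhs (0 : X)).
  exact/linear_bounded_continuous.
exists (re_part M) => [|x]; first exact/re_part_ge0/ltW.
rewrite -(@of_real_le R c) of_realM (re_partK (ltW M0)) -!rnormE; exact: LM.
Qed.

Lemma bochner_integral_ae_eq X D (f g : R -> X) (y : X) :
  (\forall x \ae mu, D x -> f x = g x) ->
  is_bochner_integral D f y -> measurable D -> is_bochner_integral D g y.
Proof.
move=> fg + mD => /(bochner_integralP _ _ mD)[s [G [[ss sf mG sG G0] sy]]].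
apply/(bochner_integralP _ _ mD); exists s, G; split=> //; split=> //.
  by apply: (filterS2 ae_filter _ fg sf) => x fgx sfx Dx; rewrite -fgx //; exact: sfx.
by move=> n; apply: (filterS2 ae_filter _ fg (sG n)) => x fgx sGx Dx; rewrite -fgx // sGx.
Qed.

(** If [M] bounds the operator [L], the functions [L \o s n] approximate [L \o f] with error at most
    [M * G n], and [L] commutes with the integral of simple functions. *)
Lemma bochner_integral_linear X Y D (L : X -> Y) (f : R -> X) (y : X) :
  measurable D -> (mu D < +oo)%E -> bounded_operator L ->
  is_bochner_integral D f y -> is_bochner_integral D (fun x => L (f x)) (L y).
Proof.
move=> mD fD bL; have [M M0 LM] := bounded_operator_rnorm bL.
have [linL contL] := bL.
pose L' : {linear X -> Y} := HB.pack L (GRing.isLinear.Build _ _ _ _ L linL).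
move=> /(bochner_integralP _ _ mD)[s [G [[ss sf mG sG G0] sy]]].
have ssL n : simple_fun (L \o s n).
  have [fs ms] := ss n; have [A _ sA] := simple_fun_seq (ss n); split.
    by rewrite -(image_comp (s n) L); exact: finite_image.
  by move=> v; exact: (measurable_index sA ms (L @^-1` [set v])).
apply/(bochner_integralP _ _ mD).
exists (fun n => L \o s n), (fun n x => (M%:E * G n x)%E); split; last first.
  under eq_fun do rewrite (simple_integral_linear mD fD linL (ss _)).
  by apply: continuous_cvg => //; exact: contL.
split=> //.
- apply: filterS sf => x sfx /sfx sfx'.
  by apply: continuous_cvg sfx'; exact: contL.
- move=> n; have [mGn Gn] := mG n; split; first exact: measurable_funeM.
  by move=> x; rewrite mule_ge0.
- move=> n; apply: filterS (sG n) => x sGx Dx /=.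
  rewrite -[L (f x)]/(L' (f x)) -[L (s n x)]/(L' (s n x)) -linearB.
  apply: (@le_trans _ _ (M%:E * (rnorm (f x - s n x))%:E)%E).
    by rewrite -EFinM lee_fin LM.
  by rewrite lee_wpmul2l ?lee_fin // sGx.
- rewrite (_ : (fun n => _) = (fun n => M%:E * \int[mu]_(x in D) G n x)%E).
    by rewrite -[X in _ --> X](mule0 M%:E); exact: cvgeZl.
  apply/funext => n; have [mGn Gn] := mG n.
  by rewrite ge0_integralZl_EFin //; exact: measurable_funTS.
Qed.

Lemma bochner_integral_addr X D (t : R) (f : R -> X) (y : X) :
  measurable D -> is_bochner_integral D f y ->
  is_bochner_integral ((fun x => x + t) @^-1` D) (fun x => f (x + t)) y.
Proof.
move=> mD; have mDt := measurable_preimage_addr t mD.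
move=> /(bochner_integralP _ _ mD)[s [G [[ss sf mG sG G0] sy]]].
apply/(bochner_integralP _ _ mDt).
exists (fun n x => s n (x + t)), (fun n x => G n (x + t)); split; last first.
  rewrite (_ : (fun n => _) = fun n => simple_integral D (s n)) //.
  apply/funext => n; have [A uA sA] := simple_fun_seq (ss n); have [_ ms] := ss n.
  rewrite /simple_integral (_ : range (fun x => s n (x + t)) = range (s n)).
    apply: eq_fsbigr => v _; congr (of_real c (fine _) *: _).
    rewrite -(lebesgue_measure_addr t (measurableI _ _ mD (ms v))).
    by congr (mu _).
  apply/seteqP; split=> [_ [x _ <-]|_ [x _ <-]]; first by exists (x + t).
  by exists (x - t) => //; rewrite subrK.
split.
- by move=> n; exact: simple_fun_addr.
- exact: (ae_addr t sf).
- move=> n; have [mGn Gn] := mG n; split=> //.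
  by apply: (measurableT_comp mGn); exact: measurable_addr.
- by move=> n; exact: (ae_addr t (sG n)).
- rewrite (_ : (fun n => _) = (fun n => \int[mu]_(x in D) G n x)%E) //.
  by apply/funext => n; have [mGn Gn] := mG n; exact: ge0_integral_addr.
Qed.

Lemma bochner_integral_setU X (D1 D2 : set RT) (f : R -> X) (y1 y2 : X) :
  measurable D1 -> measurable D2 -> (mu D1 < +oo)%E -> (mu D2 < +oo)%E ->
  mu (D1 `&` D2) = 0%E ->
  is_bochner_integral D1 f y1 -> is_bochner_integral D2 f y2 ->
  is_bochner_integral (D1 `|` D2) f (y1 + y2).
Proof.
move=> mD1 mD2 f1 f2 D120.
have mU : measurable (D1 `|` D2) by exact: measurableU.
move=> /(bochner_integralP _ _ mD1)[s1 [G1 [[ss1 sf1 mG1 sG1 G10] sy1]]].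
move=> /(bochner_integralP _ _ mD2)[s2 [G2 [[ss2 sf2 mG2 sG2 G20] sy2]]].
(* On the overlap [s n] follows [s1 n]; it may differ from [s2 n] there, but the overlap is a null
   set and does not affect the integral over [D2]. *)
pose s n x := if x \in D1 then s1 n x else s2 n x.
have ss n : simple_fun (s n).
  by apply: simple_fun_if => //; rewrite set_mem_set.
apply/(bochner_integralP _ _ mU).
exists s, (fun n x => ((G1 n \_ D1) x + (G2 n \_ D2) x)%E); split; last first.
  rewrite (_ : (fun n => _) =
    (fun n => simple_integral D1 (s1 n) + simple_integral D2 (s2 n))).
    exact: cvgD.
  apply/funext => n; rewrite simple_integralU //; congr (_ + _).
    apply: simple_integral_ae_eq => //; apply: nearW => x D1x.
    by rewrite /s mem_set.
  apply: simple_integral_ae_eq => //; exists (D1 `&` D2); split=> //.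
    exact: measurableI.
  move=> x /= sx; apply: contrapT => D12x; apply: sx => D2x.
  by rewrite /s memNset // => D1x; apply: D12x.
have G0 n : (forall x, 0 <= (G1 n \_ D1) x)%E /\ (forall x, 0 <= (G2 n \_ D2) x)%E.
  have [[_ G1n] [_ G2n]] := (mG1 n, mG2 n).
  by split=> x; rewrite patchE; case: ifP.
have mG n : measurable_fun setT (G1 n \_ D1) /\ measurable_fun setT (G2 n \_ D2).
  have [[mG1n _] [mG2n _]] := (mG1 n, mG2 n).
  by split; [apply/(measurable_restrictT _ mD1)|apply/(measurable_restrictT _ mD2)];
    apply: measurable_funTS.
split=> //.
- apply: (filterS2 ae_filter _ sf1 sf2) => x sf1x sf2x Ux; rewrite /s.
  have [/set_mem D1x|D1x] := boolP (x \in D1).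
    exact: sf1x.
  by apply: sf2x; case: Ux => // /mem_set; rewrite (negbTE D1x).
- move=> n; have [[G1n G2n] [mG1n mG2n]] := (G0 n, mG n).
  split=> [|x]; last by rewrite adde_ge0.
  exact: emeasurable_funD.
- move=> n; apply: (filterS2 ae_filter _ (sG1 n) (sG2 n)) => x sG1x sG2x Ux; rewrite /s.
  have [G1n G2n] := G0 n; case: ifPn => [/[dup] D1x /set_mem/sG1x le1|D1x].
    by rewrite [X in (X + _)%E]patchE D1x (le_trans le1) // leeDl.
  have D2x : D2 x by case: Ux => // /mem_set; rewrite (negbTE D1x).
  by rewrite [X in (_ + X)%E]patchE mem_set // (le_trans (sG2x D2x)) // leeDr.
- rewrite (_ : (fun n => _) = (fun n =>
      \int[mu]_(x in D1) G1 n x + \int[mu]_(x in D2) G2 n x)%E).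
    by rewrite -[X in _ --> X]adde0; apply: cvgeD.
  apply/funext => n; have [[G1n G2n] [mG1n mG2n]] := (G0 n, mG n).
  rewrite ge0_integralD //; [|exact: measurable_funTS..].
  rewrite -!integral_mkcondr setIUl setIid (setUidl (@subIsetr _ D2 D1)).
  by rewrite setIUl setIid (setUidr (@subIsetr _ D1 D2)).
Qed.

Lemma bochner_approx_subset X (D D' : set RT) (f : R -> X) s G :
  measurable D -> measurable D' -> D' `<=` D ->
  bochner_approx D f s G -> bochner_approx D' f s G.
Proof.
move=> mD mD' D'D [ss sf mG sG G0]; split=> //.
- by apply: filterS sf => x + /D'D.
- by move=> n; apply: filterS (sG n) => x + /D'D.
- apply: (squeeze_cvge _ (cvg_cst 0%E) G0); apply: nearW => n; have [mGn Gn] := mG n.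
  rewrite integral_ge0 //=; apply: ge0_subset_integral => //; exact: measurable_funTS.
Qed.

(** Existence of the integral over [D2] is part of the conclusion. The approximating sequence of the
    union also serves on [D1], where its integrals must tend to [y1], and on [D2], where its
    integrals are the differences. *)
Lemma bochner_integral_setD X (D1 D2 : set RT) (f : R -> X) (y y1 : X) :
  measurable D1 -> measurable D2 -> (mu D1 < +oo)%E -> (mu D2 < +oo)%E ->
  mu (D1 `&` D2) = 0%E ->
  is_bochner_integral (D1 `|` D2) f y -> is_bochner_integral D1 f y1 ->
  is_bochner_integral D2 f (y - y1).
Proof.
move=> mD1 mD2 f1 f2 D120.
have mU : measurable (D1 `|` D2) by exact: measurableU.
move=> /(bochner_integralP _ _ mU)[s [G [sG sy]]].
move=> /(bochner_integralP _ _ mD1)[s1 [G1 [sG1 sy1]]].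
have sD1 := bochner_approx_subset mU mD1 (@subsetUl _ D1 D2) sG.
apply/(bochner_integralP _ _ mD2); exists s, G; split.
  exact: bochner_approx_subset sG.
have sy1' := bochner_approx_cvg mD1 f1 sG1 sD1 sy1.
rewrite (_ : (fun n => _) =
  (fun n => simple_integral (D1 `|` D2) (s n) - simple_integral D1 (s n))).
  exact: cvgB.
apply/funext => n; have [ss _ _ _ _] := sG.
by rewrite (simple_integralU mD1 mD2 f1 f2 D120 (ss n)) addrAC subrr add0r.
Qed.

Lemma bochner_integral_null X D (f : R -> X) (y : X) :
  measurable D -> mu D = 0%E -> is_bochner_integral D f y -> y = 0.
Proof.
move=> mD D0 [s [ss _ _ sy]].
suff s0 n : simple_integral D (s n) = 0.
  by move: sy; under eq_fun do rewrite s0; move=> /(cvg_unique _ (cvg_cst 0)) ->.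
rewrite /simple_integral fsbig1 // => v _.
rewrite (_ : mu _ = 0%E) ?of_real0 ?scale0r //; apply/eqP.
rewrite -measure_le0 -D0 le_measure ?inE //; apply: measurableI => //.
by case: (ss n).
Qed.

End bochner_theory.

(** * Splitting the convolution integral at an intermediate time *)

Section convolution.
Context {R : realType} {c : field_kind}.
Local Notation K := (base_field R c).
Local Notation mu := (@lebesgue_measure R).

Let ae_filter : Filter (almost_everywhere mu) := ae_filter_ringOfSetsType mu.

Variables (X W : normedModType K) (T : R -> X -> X) (B : W -> X).
Hypothesis hT : C0_semigroup T.

Let mI (t : R) : measurable (`[0, t]%classic : set (measurableTypeR R)).
Proof. exact: measurable_itv. Qed.

Let fI (t : R) : (mu (`[0%R, t]%classic) < +oo)%E.
Proof. by rewrite lebesgue_measure_itv /=; case: ifP => // _; rewrite ltry. Qed.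

Lemma eq_convolution (t : R) (u v : R -> W) (z : X) :
  (\forall s \ae mu, 0 <= s <= t -> u s = v s) ->
  is_convolution T B t u z -> is_convolution T B t v z.
Proof.
move=> uv uz; apply: bochner_integral_ae_eq uz (mI t).
by apply: (@filterS _ _ ae_filter _ _ _ uv) => s uvs; rewrite /= in_itv /= => /uvs ->.
Qed.

Lemma is_convolution0 (u : R -> W) (z : X) : is_convolution T B 0 u z -> z = 0.
Proof.
by apply: bochner_integral_null => //; rewrite set_itv1 lebesgue_measure_set1.
Qed.

Section split.
Variables (t h : R) (w : R -> W).
Hypotheses (t0 : 0 <= t) (h0 : 0 <= h).

(** This is the interval [[t, t + h]], written as a preimage so that the translation of Bochner
    integrals applies to it directly. *)
Let D2 : set R := (fun x => x - t) @^-1` `[0, h]%classic.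

Let D2E : D2 = `[t, t + h]%classic.
Proof.
by apply/seteqP; split=> x; rewrite /D2 /= !in_itv /= subr_ge0 lerBlDr addrC.
Qed.

Let mD2 : measurable (D2 : set (measurableTypeR R)).
Proof. by rewrite D2E; exact: measurable_itv. Qed.

Let fD2 : (mu D2 < +oo)%E.
Proof.
by rewrite D2E lebesgue_measure_itv /=; case: ifP => // _; rewrite -EFinB ltry.
Qed.

Let D120 : mu (`[0%R, t]%classic `&` D2) = 0%E.
Proof.
rewrite D2E (_ : _ `&` _ = [set t]) ?lebesgue_measure_set1 //.
apply/seteqP; split=> x /=; rewrite !in_itv /=.
  by move=> [/andP[_ xt] /andP[tx _]]; apply/eqP; rewrite eq_le xt tx.
by move=> ->; rewrite t0 lexx lerDl.
Qed.

Let D12U : `[0, t + h]%classic = `[0, t]%classic `|` D2.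
Proof.
rewrite D2E; apply/seteqP; split=> x /=; rewrite !in_itv /=.
  by move=> /andP[x0 xth]; have [xt|/ltW tx] := leP x t; [left|right]; apply/andP.
move=> [/andP[x0 xt]|/andP[tx ->]]; last by rewrite (le_trans t0 tx).
by rewrite x0 (le_trans xt) // lerDl.
Qed.

(** The bounded operator [T h] passes under the integral, and the semigroup law merges it with
    [T (t - s)], since [t - s] is nonnegative on [[0, t]]. *)
Let head_integral (z : X) : is_convolution T B t w z ->
  is_bochner_integral `[0, t]%classic (fun s => T (t + h - s) (B (w s))) (T h z).
Proof.
have [bT _ TD _] := hT.
move=> /(bochner_integral_linear (mI t) (fI t) (bT h h0)) wz.
apply: bochner_integral_ae_eq wz (mI t); apply: (nearW ae_filter) => s /=.
rewrite in_itv /= => /andP[s0 st]; rewrite -TD ?subr_ge0 //.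
by congr (T _ _); rewrite addrA (addrC h).
Qed.

(** Substitution of [s - t] for [s]. Both directions are used: one for gluing, the other for
    restarting. *)
Let tail_integral (z : X) : is_convolution T B h (fun s => w (s + t)) z <->
  is_bochner_integral D2 (fun s => T (t + h - s) (B (w s))) z.
Proof.
split=> [wz|wz].
  have {}wz := bochner_integral_addr (- t) (mI h) wz.
  apply: bochner_integral_ae_eq wz mD2; apply: (nearW ae_filter) => s _ /=.
  by rewrite subrK; congr (T _ _); rewrite opprB addrA (addrC h) addrAC.
have {wz} := bochner_integral_addr t mD2 wz.
rewrite (_ : _ @^-1` D2 = `[0, h]%classic); last first.
  by apply/seteqP; split=> x; rewrite /D2 /= addrK.
move=> wz; apply: bochner_integral_ae_eq wz (mI h); apply: (nearW ae_filter) => s _ /=.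
by congr (T _ _); rewrite opprD (addrC (- s)) addrACA subrr add0r.
Qed.

Lemma is_convolution_concat (z1 z2 : X) : is_convolution T B t w z1 ->
  is_convolution T B h (fun s => w (s + t)) z2 ->
  is_convolution T B (t + h) w (T h z1 + z2).
Proof.
move=> /head_integral wz1 /tail_integral wz2; rewrite /is_convolution D12U.
exact: bochner_integral_setU.
Qed.

Lemma is_convolution_shift (z z1 : X) : is_convolution T B (t + h) w z ->
  is_convolution T B t w z1 ->
  is_convolution T B h (fun s => w (s + t)) (z - T h z1).
Proof.
rewrite {1}/is_convolution D12U => wz /head_integral wz1; apply/tail_integral.
exact: bochner_integral_setD wz wz1.
Qed.

End split.
End convolution.

(** * Mild solutions: restarting, gluing and extension to a maximal one *)

Lemma within_continuous_addr (R : realType) (X : topologicalType) (A : set R)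
    (r : R) (x : R -> X) : {within A, continuous x} ->
  {within (fun s => s + r) @^-1` A, continuous (fun s => x (s + r))}.
Proof.
move=> /subspace_continuousP cx; apply/subspace_continuousP => s As.
apply: (cvg_comp (fun s => s + r) x _ (cx _ As)) => P.
rewrite /within /= => rP.
have : s0 + r @[s0 --> s] --> s + r by apply: cvgD; [exact: cvg_id|exact: cvg_cst].
by move=> /(_ _ rP).
Qed.

Lemma lte_EFin_dense (R : realType) (t : R) (b : \bar R) : (t%:E < b)%E ->
  exists2 tau : R, t < tau & (tau%:E < b)%E.
Proof.
case: b => [r|_|] //; last by exists (t + 1); rewrite ?ltrDl ?ltry.
by rewrite lte_fin => /midf_lt[]; exists ((t + r) / 2).
Qed.

Section mild_solution_theory.
Context {R : realType} {c : field_kind}.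
Local Notation K := (base_field R c).
Local Notation mu := (@lebesgue_measure R).

Let ae_filter : Filter (almost_everywhere mu) := ae_filter_ringOfSetsType mu.

Variables (X U V Xm1 : normedModType K) (i : X -> Xm1).
Variables (T : R -> X -> X) (Tm1 : R -> Xm1 -> Xm1).
Variables (B : U -> Xm1) (B2 : V -> Xm1) (f : X * U -> V).
Hypothesis inj_i : injective i.
Hypotheses (hT : C0_semigroup T) (hTm1 : extends_semigroup i T Tm1).
Local Notation mild_on := (mild_solution_on i T Tm1 B B2 f).
Local Notation mild := (mild_solution i T Tm1 B B2 f).
Local Notation maximal := (maximal_mild_solution i T Tm1 B B2 f).

Lemma mild_solution_on_le (x0 : X) (u : R -> U) (tau tau' : R) (x : R -> X) :
  tau' <= tau -> mild_on x0 u tau x -> mild_on x0 u tau' x.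
Proof.
move=> le [cx hx]; split.
  apply: continuous_subspaceW cx => s /=; rewrite !in_itv /=.
  by move=> /andP[-> /le_trans]; exact.
by move=> t /andP[t0 tt]; apply: hx; rewrite t0 (le_trans tt).
Qed.

(** The input enters only through integrals, so equality almost everywhere is enough for it, while
    the trajectory has to agree at every time of [[0, tau]]. *)
Lemma eq_mild_solution_on (x0 : X) (u v : R -> U) (tau : R) (x y : R -> X) :
  (forall t, 0 <= t <= tau -> x t = y t) ->
  (\forall t \ae mu, 0 <= t <= tau -> u t = v t) ->
  mild_on x0 u tau x -> mild_on x0 v tau y.
Proof.
move=> xy uv [cx hx]; split.
  apply: subspace_eq_continuous cx => s /set_mem /=; rewrite in_itv /=; exact: xy.
move=> t /[dup] t0tau /andP[t0 ttau].
have {}uv : \forall s \ae mu, 0 <= s <= t -> u s = v s.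
  apply: (@filterS _ _ ae_filter _ _ _ uv) => s us /andP[s0 st].
  by apply: us; rewrite s0 (le_trans st).
have [z2 [z [cz2 cz xE]]] := hx t t0tau; exists z2, z; split.
- apply: eq_convolution cz2.
  apply: (@filterS _ _ ae_filter _ _ _ uv) => s us /[dup] s0t /us ->.
  by rewrite xy //; move: s0t => /andP[-> st]; rewrite (le_trans st).
- exact: eq_convolution cz.
- by rewrite -xy.
Qed.

(** At time 0 both convolutions are integrals over a single point, so the equation reads
    [i (x 0) = i x0], and [i] is injective. *)
Lemma mild_solution_on_initial (x0 : X) (u : R -> U) (tau : R) (x : R -> X) :
  0 <= tau -> mild_on x0 u tau x -> x 0 = x0.
Proof.
move=> tau0 [_ /(_ 0)]; rewrite lexx tau0 => /(_ isT)[z2 [z [cz2 cz xE]]].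
apply: inj_i; rewrite xE (is_convolution0 cz2) (is_convolution0 cz) !addr0.
by have [_ -> _ _] := hT.
Qed.

Lemma mild_solution_initial (x0 : X) (u : R -> U) (t1 : \bar R) (x : R -> X) :
  mild x0 u t1 x -> x 0 = x0.
Proof.
move=> [t10 hx]; have [tau tau0 taut1] := lte_EFin_dense t10.
exact: mild_solution_on_initial (ltW tau0) (hx _ tau0 taut1).
Qed.

Lemma mild_solution_on_shift (x0 : X) (u : R -> U) (t h : R) (x : R -> X) :
  0 <= t -> 0 <= h -> mild_on x0 u (t + h) x ->
  mild_on (x t) (shift_input t u) h (shift_input t x).
Proof.
move=> t0 h0 [cx hx]; have [hS iT] := hTm1; have [bS _ _ _] := hS.
have [_ _ TD _] := hT; split.
  apply: continuous_subspaceW (within_continuous_addr (r := t) cx) => s /=.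
  by rewrite !in_itv /= => /andP[s0 sh]; rewrite addr_ge0 //= addrC lerD2l.
move=> s /andP[s0 sh].
have [|y2 [y [cy2 cy yE]]] := hx t; first by rewrite t0 lerDl.
have [|z2 [z [cz2 cz zE]]] := hx (t + s).
  by rewrite addr_ge0 //= lerD2l.
(* The integrals up to [t + s], minus the contributions of [[0, t]] transported by [Tm1 s]. These
   contributions cancel against those in [Tm1 s (i (x t))]. *)
exists (z2 - Tm1 s y2), (z - Tm1 s y); split.
- exact: (is_convolution_shift hS t0 s0 cz2 cy2).
- exact: (is_convolution_shift hS t0 s0 cz cy).
pose S : {linear Xm1 -> Xm1} :=
  HB.pack (Tm1 s) (GRing.isLinear.Build _ _ _ _ (Tm1 s) (bS s s0).1).
rewrite /shift_input -iT // yE -[Tm1 s]/(S : Xm1 -> Xm1) !linearD /= iT //.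
rewrite -TD // (addrC s) zE; set a := i _.
rewrite -!addrA; congr (a + _); set p := S y2; set q := S y.
by rewrite (addrCA q z2) (addrCA p z2) (addrCA q (- p)) addNKr (addrCA q z) subrr addr0.
Qed.

Lemma mild_solution_on_concat (x0 : X) (u : R -> U) (t h : R) (x y : R -> X) :
  0 <= t -> 0 <= h -> mild_on x0 u t x -> mild_on (x t) (shift_input t u) h y ->
  mild_on x0 u (t + h) (concat_inputs t x y).
Proof.
move=> t0 h0 mx my; have y0 := mild_solution_on_initial h0 my.
have [hS iT] := hTm1; have [bS _ _ _] := hS; have [_ _ TD _] := hT.
pose w := concat_inputs t x y.
have wx s : s <= t -> w s = x s by rewrite /w /concat_inputs => ->.
(* The concatenation takes the first branch at [s = t], but [y 0 = x t] makes the second formula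
   valid there as well. *)
have wy s : t <= s -> w s = y (s - t).
  rewrite le_eqVlt => /predU1P[<-|ts]; first by rewrite wx // subrr.
  by rewrite /w /concat_inputs leNgt ts.
have mw : mild_on x0 u t w.
  by apply: eq_mild_solution_on mx => [s /andP[_ /wx]//|]; exact: (nearW ae_filter).
split; rewrite -/w.
  have -> : `[0, t + h]%classic = `[0, t]%classic `|` `[t, t + h]%classic.
    apply/seteqP; split=> s /=; rewrite !in_itv /=.
      by move=> /andP[s0 sth]; have [st|/ltW ts] := leP s t; [left|right]; apply/andP.
    move=> [/andP[s0 st]|/andP[ts ->]]; last by rewrite (le_trans t0 ts).
    by rewrite s0 (le_trans st) // lerDl.
  (* Continuity on each of two closed sets gives continuity on their union. *)
  apply: withinU_continuous; [exact: interval_closed|exact: interval_closed|by case: mw|].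
  apply: (@subspace_eq_continuous _ _ _ (fun s => y (s - t))).
    by move=> s /set_mem /=; rewrite in_itv /= => /andP[ts _]; exact/esym/wy.
  have [cy _] := my.
  apply: continuous_subspaceW (within_continuous_addr (r := - t) cy) => s /=.
  by rewrite !in_itv /= subr_ge0 lerBlDr (addrC h).
move=> s /andP[s0 sth]; have [st|/ltW ts] := leP s t.
  by have [_ hw] := mw; apply: hw; rewrite s0.
have st0 : 0 <= s - t by rewrite subr_ge0.
have [_ /(_ t)] := mw; rewrite t0 lexx => /(_ isT)[z2 [z [cz2 cz xE]]].
have [_ /(_ (s - t))] := my; rewrite st0 lerBlDl => /(_ sth)[y2 [y1 [cy2 cy yE]]].
have {}cy2 : is_convolution Tm1 B2 (s - t) (fun r => f (w (r + t), u (r + t))) y2.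
  apply: eq_convolution cy2; apply: (nearW ae_filter) => r /andP[r0 _].
  by rewrite wy ?lerDr // addrK.
(* The integrals over [[0, t]], transported to time [s], plus those of the second piece. *)
exists (Tm1 (s - t) z2 + y2), (Tm1 (s - t) z + y1).
have sE : t + (s - t) = s by rewrite addrC subrK.
split.
- by have := is_convolution_concat hS t0 st0 cz2 cy2; rewrite sE.
- by have := is_convolution_concat hS t0 st0 cz cy; rewrite sE.
rewrite wy // yE -(wx t) // -iT // xE.
pose S : {linear Xm1 -> Xm1} :=
  HB.pack (Tm1 (s - t)) (GRing.isLinear.Build _ _ _ _ _ (bS _ st0).1).
rewrite -[Tm1 (s - t)]/(S : Xm1 -> Xm1) !linearD /= iT // -TD // subrK.
by rewrite -!addrA; congr (_ + _); congr (_ + _); rewrite addrCA.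
Qed.

Lemma mild_solution_shift (x0 : X) (u v : R -> U) (t1 : \bar R) (t : R) (x : R -> X) :
  0 <= t -> (t%:E < t1)%E ->
  (\forall s \ae mu, 0 <= s -> v s = shift_input t u s) ->
  mild x0 u t1 x -> mild (x t) v (t1 - t%:E)%E (shift_input t x).
Proof.
move=> t0 tt1 vu [t10 hx]; split=> [|tau tau0 taut]; first by rewrite sube_gt0.
apply: (@eq_mild_solution_on _ (shift_input t u) _ _ (shift_input t x)) => //.
  by apply: (@filterS _ _ ae_filter _ _ _ vu) => s vus /andP[/vus ->].
apply: (mild_solution_on_shift t0 (ltW tau0)).
apply: hx; first by rewrite ltr_wpDl.
by rewrite EFinD addeC -lteBrDr.
Qed.

Lemma mild_solution_concat (x0 : X) (u v : R -> U) (t1 : \bar R) (t : R)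
    (x y : R -> X) : 0 <= t ->
  (\forall s \ae mu, 0 <= s -> v s = shift_input t u s) ->
  mild_on x0 u t x -> mild (x t) v t1 y ->
  mild x0 u (t%:E + t1)%E (concat_inputs t x y).
Proof.
move=> t0 vu mx [t10 hy]; split=> [|tau tau0 taut].
  by rewrite (lt_le_trans t10) // leeDr // lee_fin.
have [tau_t|t_tau] := leP tau t.
  apply: eq_mild_solution_on (mild_solution_on_le tau_t mx);
    last exact: (nearW ae_filter).
  by move=> s /andP[_ st]; rewrite /concat_inputs (le_trans st).
have -> : tau = t + (tau - t) by rewrite addrC subrK.
have tt0 : 0 < tau - t by rewrite subr_gt0.
apply: (mild_solution_on_concat t0 (ltW tt0) mx).
apply: (@eq_mild_solution_on _ v _ _ y) => //.
  by apply: (@filterS _ _ ae_filter _ _ _ vu) => s vus /andP[/vus ->].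
by apply: hy => //; rewrite EFinB lteBlDl.
Qed.

(** Zorn's lemma for the solutions that prolong [x1], ordered by prolongation. This is only a
    preorder: two representatives of one solution may differ outside its lifetime. *)
Lemma mild_solution_sub_maximal (x0 : X) (u : R -> U) (t1 : \bar R) (x1 : R -> X) :
  mild x0 u t1 x1 ->
  exists t2 x2, [/\ maximal x0 u t2 x2, (t1 <= t2)%E & agree_before t1 x1 x2].
Proof.
move=> m1.
pose E := {p : \bar R * (R -> X) |
  mild x0 u p.1 p.2 /\ (t1 <= p.1)%E /\ agree_before t1 x1 p.2}.
pose e1 : E := exist _ (t1, x1) (conj m1 (conj (lexx t1) (fun _ _ _ => erefl))).
pose le_sol (p q : E) : bool :=
  `[< ((sval p).1 <= (sval q).1)%E /\ agree_before (sval p).1 (sval p).2 (sval q).2 >].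
have [||S Stot|[[t2 x2] [m2 [t12 x12]]] max2] := @ZL_preorder E e1 le_sol.
- by move=> p; apply/asboolP.
- move=> q p r /asboolP[pq apq] /asboolP[qr aqr]; apply/asboolP; split.
    exact: le_trans qr.
  by move=> t t0 tp; rewrite aqr ?apq // (lt_le_trans tp).
- have [[p0 Sp0]|S0] := pselect (S !=set0); last by exists e1 => s Ss; case: S0; exists s.
  (* An upper bound of a nonempty chain is its union, which lives up to the supremum of the
     lifetimes. At time [t] it takes the value of some chosen member alive at [t], and 0 if there is
     none; on a chain the choice does not matter. *)
  pose ts := ereal_sup [set (sval p).1 | p in S].
  pose xs t := if pselect (exists p, S p /\ (t%:E < (sval p).1)%E) is left H
    then (sval (projT1 (cid H))).2 t else 0.
  have xsE p : S p -> agree_before (sval p).1 (sval p).2 xs.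
    move=> Sp t t0 tp; rewrite /xs; case: pselect => [H|[]]; last by exists p.
    case: cid => q [Sq tq] /=.
    by have [/asboolP[_ ->]|/asboolP[_ <-]] := Stot _ _ Sq Sp.
  have leS p : S p -> ((sval p).1 <= ts)%E.
    by move=> Sp; apply: ereal_sup_ubound; exists p.
  (* Each [tau] below the supremum is below the lifetime of some member, which supplies continuity
     and the equation on [[0, tau]]. *)
  have ms : mild x0 u ts xs.
    split; first by apply: lt_le_trans (leS _ Sp0); have [[]] := svalP p0.
    move=> tau tau0 /ereal_sup_gt[_ [p Sp <-] taup].
    have [[_ /(_ _ tau0 taup) mp] _] := svalP p.
    apply: eq_mild_solution_on mp; last exact: (nearW ae_filter).
    by move=> t /andP[t0 ttau]; rewrite (xsE p) // (le_lt_trans _ taup) ?lee_fin.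
  have [_ [t1p x1p]] := svalP p0.
  have ext : mild x0 u ts xs /\ (t1 <= ts)%E /\ agree_before t1 x1 xs.
    split=> //; split; first exact: le_trans (leS _ Sp0).
    by move=> t t0 tt1; rewrite (xsE _ Sp0 _ t0 (lt_le_trans tt1 t1p)) x1p.
  exists (exist _ (ts, xs) ext) => p Sp; apply/asboolP; split; [exact: leS|exact: xsE].
exists t2, x2; split=> //; split=> // t3 x3 m3 [t23 x23].
have ext : mild x0 u t3 x3 /\ (t1 <= t3)%E /\ agree_before t1 x1 x3.
  split=> //; split; first exact: le_trans (ltW t23).
  by move=> t t0 tt1; rewrite (x23 _ t0 (lt_le_trans tt1 t12)); exact: (x12 t t0 tt1).
(* A strict extension would lie above the Zorn-maximal element, hence also below it, forcing
   [t3 <= t2]. *)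
have /asboolP[] : le_sol (exist _ (t3, x3) ext)
    (exist _ (t2, x2) (conj m2 (conj t12 x12))).
  by apply: max2; apply/asboolP; split=> //; exact: ltW.
by rewrite leNgt t23.
Qed.

(** The given solution prolongs to a maximal one, which by uniqueness has the lifetime and the
    values of [x2]. *)
Lemma mild_solution_le_maximal (x0 : X) (u : R -> U) (t1 t2 : \bar R) (x1 x2 : R -> X) :
  unique_maximal_mild_solution i T Tm1 B B2 f x0 u ->
  maximal x0 u t2 x2 -> mild x0 u t1 x1 ->
  (t1 <= t2)%E /\ agree_before t1 x1 x2.
Proof.
move=> [t [x [_ uniq_x]]] /uniq_x[-> x2E] /mild_solution_sub_maximal[t3 [x3 [+ t13 x13]]].
move=> /uniq_x[t3E x3E]; rewrite t3E in t13; split=> // s s0 st1.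
have st : (s%:E < t)%E by exact: lt_le_trans t13.
by rewrite x2E // -x3E // x13.
Qed.

End mild_solution_theory.

(** * Essentially bounded inputs: shift invariance and concatenation *)

Section Linf_inputs.
Context {R : realType} {c : field_kind}.
Variable U : normedModType (base_field R c).
Local Notation mu := (@lebesgue_measure R).
Local Notation Rp := (`[0, +oo[%classic : set R).

Let ae_filter : Filter (almost_everywhere mu) := ae_filter_ringOfSetsType mu.

Lemma agree_on_aeP (W : Type) (D : set R) (u v : R -> W) :
  agree_on mu.-negligible D u v <-> \forall s \ae mu, D s -> u s = v s.
Proof.
split=> [[E [N [mN N0 EN]] uv]|uv].
  exists N; split=> // s /= Ds; apply: EN; apply: contrapT => Es.
  by apply: Ds => Ds; exact: uv.
by exists (~` [set s | D s -> u s = v s]) => // s Ds /contrapT; exact.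
Qed.

Lemma Linf_repr_is_Linf (u : Linf U) : is_Linf (Linf_repr u).
Proof. exact/asboolP/(LinfFun_valP (repr u)). Qed.

Lemma Linf_repr_exists (u : R -> U) : is_Linf u ->
  exists v : Linf U, \forall s \ae mu, Rp s -> Linf_repr v s = u s.
Proof.
move=> Lu; have Lu' : u \in @Linf_pred R c U by exact/asboolP.
exists (\pi_(Linf U)%qT (MkLinfFun Lu')); exact: (Linf_repr_pi (MkLinfFun Lu')).
Qed.

Lemma Linf_norm_leP (u : Linf U) (M : R) : 0 <= M ->
  (\forall s \ae mu, Rp s -> rnorm (Linf_repr u s) <= M) -> `|u| <= of_real c M.
Proof.
move=> M0 /(ess_normP _ M0) uM; rewrite of_real_le -lee_fin.
by rewrite -ess_norm_Linf.
Qed.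

Lemma is_Linf_bound (u : R -> U) (M : R) : 0 <= M -> strongly_measurable Rp u ->
  (\forall s \ae mu, Rp s -> rnorm (u s) <= M) -> is_Linf u.
Proof.
move=> M0 mu_ /(ess_normP _ M0) uM; split=> //.
by apply: le_lt_trans uM _; rewrite ltry.
Qed.

Lemma strongly_measurable_shift (u : R -> U) (t : R) : 0 <= t ->
  strongly_measurable Rp u -> strongly_measurable Rp (shift_input t u).
Proof.
move=> t0 [s ss su]; exists (fun n x => s n (x + t)).
  by move=> n; exact: simple_fun_addr.
apply: (@filterS _ _ ae_filter _ _ _ (ae_addr t su)) => x sux.
by rewrite /= in_itv /= andbT => x0; apply: sux; rewrite /= in_itv /= andbT addr_ge0.
Qed.

Lemma strongly_measurable_concat (u v : R -> U) (t : R) :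
  strongly_measurable Rp u -> strongly_measurable Rp v ->
  strongly_measurable Rp (concat_inputs t u v).
Proof.
move=> [s ss su] [r sr rv].
exists (fun n x => if x <= t then s n x else r n (x - t)).
  move=> n; apply: (simple_fun_if (b := fun x => x <= t)) => //;
    last exact: simple_fun_addr.
  rewrite (_ : [set` _] = `]-oo, t]%classic); first exact: measurable_itv.
  by apply/seteqP; split=> x; rewrite /= in_itv.
apply: (@filterS2 _ _ ae_filter _ _ _ _ su (ae_addr (- t) rv)) => x sux rvx Rpx.
rewrite /concat_inputs; have [xt|tx] := leP x t; first exact: sux.
by apply: rvx; rewrite /= in_itv /= andbT subr_ge0 ltW.
Qed.

Lemma Linf_norm_bound (u : Linf U) : exists2 M, 0 <= M /\ `|u| = of_real c M &
  \forall s \ae mu, Rp s -> rnorm (Linf_repr u s) <= M.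
Proof.
exists (fine (ess_norm Rp (Linf_repr u))); last exact: Linf_norm_ub.
by split=> //; exact/fine_ge0/ess_norm_ge0.
Qed.

Lemma Linf_input_space : input_space mu.-negligible (@Linf_repr R c U).
Proof.
split.
- move=> a u v; apply/agree_on_aeP.
  apply: (@filterS2 _ _ ae_filter _ _ _ _ (Linf_reprD (a *: u) v) (Linf_reprZ a u)).
  by move=> s uvs us Rps; rewrite uvs // us.
- by move=> u v /agree_on_aeP/Linf_eqP.
- move=> u t t0; have [M [M0 uE] uM] := Linf_norm_bound u.
  have [mu_ _] := Linf_repr_is_Linf u.
  have uM' : \forall s \ae mu, Rp s -> rnorm (shift_input t (Linf_repr u) s) <= M.
    apply: (@filterS _ _ ae_filter _ _ _ (ae_addr t uM)) => s us.
    rewrite /= in_itv /= andbT => s0.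
    by apply: us; rewrite /= in_itv /= andbT addr_ge0.
  have [v vE] := Linf_repr_exists
    (is_Linf_bound M0 (strongly_measurable_shift t0 mu_) uM').
  exists v; first exact/agree_on_aeP.
  rewrite uE; apply: Linf_norm_leP => //.
  by apply: (@filterS2 _ _ ae_filter _ _ _ _ vE uM') => s vs us Rps; rewrite vs // us.
- move=> u v t t0; have [[M [M0 _] uM] [N [N0 _] vN]] := (Linf_norm_bound u, Linf_norm_bound v).
  have [[mu_ _] [mv _]] := (Linf_repr_is_Linf u, Linf_repr_is_Linf v).
  (* The concatenation axiom asks only for membership in the input space, so the crude bound [M + N]
     is enough. *)
  have uvMN : \forall s \ae mu, Rp s ->
      rnorm (concat_inputs t (Linf_repr u) (Linf_repr v) s) <= M + N.
    apply: (@filterS2 _ _ ae_filter _ _ _ _ uM (ae_addr (- t) vN)) => s us vs Rps.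
    rewrite /concat_inputs; have [st|ts] := leP s t.
      by rewrite (le_trans (us Rps)) // lerDl.
    apply: le_trans (vs _) _; first by rewrite /= in_itv /= andbT subr_ge0 ltW.
    by rewrite lerDr.
  have [w wE] := Linf_repr_exists
    (is_Linf_bound (addr_ge0 M0 N0) (strongly_measurable_concat t mu_ mv) uvMN).
  by exists w; exact/agree_on_aeP.
Qed.

End Linf_inputs.

(** * Injectivity of the embedding into the completion, and the control system axioms *)

Lemma completion_injective (R : realType) (c : field_kind)
    (X Xm1 : completeNormedModType (base_field R c)) (DA : set X) (A : X -> X)
    (a : base_field R c) (J : X -> X) (i : X -> Xm1) :
  is_resolvent DA A a J -> is_completion J i -> injective i.
Proof.
move=> [[linJ _] AJ _] [lin_i iJ _] x y ixy.
(* Since [i x] and [J x] have equal norms, it suffices that [J] has trivial kernel. If [J z = 0],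
   the resolvent identities at [z] and at 0 have the same left-hand side, so [z = 0]; this avoids
   appealing to linearity of [A]. *)
have AJ0 z : J z = 0 -> z = 0.
  move=> Jz; have [_ <-] := AJ z; have [_] := AJ 0.
  pose J' : {linear X -> X} := HB.pack J (GRing.isLinear.Build _ _ _ _ J linJ).
  by rewrite Jz -[J 0]/(J' 0) linear0.
pose i' : {linear X -> Xm1} := HB.pack i (GRing.isLinear.Build _ _ _ _ i lin_i).
apply/eqP; rewrite -subr_eq0; apply/eqP/AJ0/normr0_eq0.
by rewrite -iJ -[i _]/(i' (x - y)) linearB /= ixy subrr normr0.
Qed.

Theorem theorem3p18 (R : realType) (c : field_kind)
    (X U V Xm1 : completeNormedModType (base_field R c))
    (T : R -> X -> X) (DA : set X) (A : X -> X)
    (hT : C0_semigroup T) (hA : generates DA A T)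
    (a : base_field R c) (J : X -> X) (hJ : is_resolvent DA A a J)
    (i : X -> Xm1) (hi : is_completion J i)
    (Tm1 : R -> Xm1 -> Xm1) (hTm1 : extends_semigroup i T Tm1)
    (B : U -> Xm1) (hB : bounded_operator B)
    (B2 : V -> Xm1) (hB2 : bounded_operator B2)
    (f : X * U -> V)
    (hBadm : infty_admissible i Tm1 B)
    (hBcont : input_map_continuous i Tm1 B)
    (hB2adm : zero_class_admissible i Tm1 B2)
    (hf : forall (u : R -> U) (x : R -> X), is_Linf u ->
      {within `[0, +oo[%classic, continuous x} ->
      is_Linf_loc (fun s => f (x s, u s)))
    (hwp : forall (x0 : X) (u : Linf U),
      unique_maximal_mild_solution i T Tm1 B B2 f x0 (Linf_repr u))
    (tm : X -> Linf U -> \bar R) (phi : R -> X -> Linf U -> X)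
    (hphi : forall (x0 : X) (u : Linf U),
      maximal_mild_solution i T Tm1 B B2 f x0 (Linf_repr u)
        (tm x0 u) (fun t => phi t x0 u)) :
  control_system (@lebesgue_measure R).-negligible
    (@Linf_repr R c U)
    [set p : R * X * Linf U | 0 <= p.1.1 /\ (p.1.1%:E < tm p.1.2 p.2)%E]
    phi.
Proof.
have inj_i := completion_injective hJ hi.
have ae_filter : Filter (almost_everywhere (@lebesgue_measure R)).
  exact: ae_filter_ringOfSetsType.
have mphi x u := (hphi x u).1.
split.
- exact: Linf_input_space.
- by move=> x u; exists (tm x u); [case: (mphi x u)|].
- by move=> x u; exact: (mild_solution_initial inj_i hT (mphi x u)).
- move=> t x u v [/= t0 tt] /agree_on_aeP uv.
  have [w /agree_on_aeP wv _] := input_shift (Linf_input_space U) v t0.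
  (* Causality, first half: on [[0, t]] the inputs agree almost everywhere, so the trajectory for
     [u] also solves the equation for [v]. *)
  have mt : mild_solution_on i T Tm1 B B2 f x (Linf_repr v) t (fun t => phi t x u).
    have [tau ttau] := lte_EFin_dense tt.
    move=> taut; have mtau := (mphi x u).2 _ (le_lt_trans t0 ttau) taut.
    apply: eq_mild_solution_on (mild_solution_on_le (ltW ttau) mtau) => //.
  have wv' : \forall s \ae lebesgue_measure, 0 <= s ->
      Linf_repr w s = shift_input t (Linf_repr v) s.
    by apply: (@filterS _ _ ae_filter _ _ _ wv) => s; rewrite /= in_itv /= andbT.
  (* Second half: continue from [phi t x u] with the shift [w] of [v]. The continuation has positive
     lifetime, so the glued solution for [v] lives strictly beyond [t], and the maximal one does
     too. *)
  have mc := mild_solution_concat inj_i hT hTm1 t0 wv' mt (mphi (phi t x u) w).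
  have [tle agree] := mild_solution_le_maximal (hwp x v) (hphi x v) mc.
  have ttw : (t%:E < t%:E + tm (phi t x u) w)%E.
    by rewrite lteDl //; case: (mphi (phi t x u) w).
  split=> [s /andP[s0 st]|].
    by split=> //=; apply: lt_le_trans tle; rewrite (le_lt_trans _ ttw) ?lee_fin.
  by rewrite (agree t) // /concat_inputs lexx.
- move=> x u; apply/subspace_continuousP => t [/= t0 tt] P phiP.
  (* Near [t] the half-open domain lies inside the closed interval [[0, tau]], on which continuity
     is known. *)
  have [tau ttau taut] := lte_EFin_dense tt.
  have [/subspace_continuousP ctau _] := (mphi x u).2 _ (le_lt_trans t0 ttau) taut.
  have tI : `[0, tau]%classic t by rewrite /= in_itv /= t0 ltW.
  have tP : \forall s \near t, `[0, tau]%classic s -> P (phi s x u).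
    exact: (ctau t tI P phiP).
  have tau_near : \forall s \near t, s < tau by exact: lt_nbhsl.
  suff : \forall s \near t, 0 <= s /\ (s%:E < tm x u)%E -> P (phi s x u) by [].
  apply: filterS2 tP tau_near => s sP stau [s0 _].
  by apply: sP; rewrite /= in_itv /= s0 ltW.
- move=> x u t h t0 h0 Dxu v /agree_on_aeP vu.
  have [_ /= th] := Dxu (t + h) (introT andP (conj (addr_ge0 t0 h0) (lexx _))).
  have tt : (t%:E < tm x u)%E by apply: le_lt_trans th; rewrite lee_fin lerDl.
  have vu' : \forall s \ae lebesgue_measure, 0 <= s ->
      Linf_repr v s = shift_input t (Linf_repr u) s.
    by apply: (@filterS _ _ ae_filter _ _ _ vu) => s; rewrite /= in_itv /= andbT.
  (* The restarted trajectory is a solution from [phi t x u] with lifetime [tm x u - t], which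
     exceeds [h]; the maximal solution with that initial value and input [v] therefore agrees with
     it at time [h]. *)
  have ms := mild_solution_shift hT hTm1 t0 tt vu' (mphi x u).
  have [tle agree] := mild_solution_le_maximal (hwp _ v) (hphi _ v) ms.
  have hth : (h%:E < tm x u - t%:E)%E by rewrite lteBrDr // -EFinD addrC.
  split; first by split=> //; exact: lt_le_trans tle.
  by rewrite agree // /shift_input addrC.
Qed.
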